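(* Let $p \in (1,2)$ be fixed. For every $n \in \mathbb{N}$ there exists a matrix $R \in \mathbb{R}^{m \times n}$, for some $m = n^{O(\log n)}$, such that for all $x \in \mathbb{R}^n$, $$\Omega(1)\,\|x\|_p \;\le\; \|Rx\|_1 \;\le\; O(1)\,\|x\|_p .$$ Moreover, $R$ can be computed deterministically in $n^{O(\log n)}$ time. All hidden constants may depend on $p$ but not on $n$ or $x$.
   Context: For $x\in\mathbb{R}^n$ and $q \ge 1$, $\|x\|_q = (\sum_i |x_i|^q)^{1/q}$. *)

(* Defs.v *)
From mathcomp Require Import all_boot all_order all_algebra.
From mathcomp Require Import all_classical all_reals all_analysis.

Set Implicit Arguments.
Unset Strict Implicit.
Unset Printing Implicit Defensive.

Import Order.TTheory GRing.Theory Num.Theory.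

Local Open Scope ring_scope.

Definition lpnorm (R : realType) (n : nat) (q : R) (x : 'cV[R]_n) : R :=
  (\sum_i `|x i 0| `^ q) `^ q^-1.

(* [n ^ (K log n)] as an upper bound, with [K] playing the role of the hidden
   constant.  For [n <= 1] the right-hand side degenerates to 1, and the
   asymptotic notation puts no constraint on [t]. *)
Definition quasipoly_le (R : realType) (K : R) (n t : nat) : Prop :=
  (2 <= n)%N -> t%:R <= n%:R `^ (K * ln n%:R).

(* Model of computation: a structured random-access machine over the naturals,
   under the logarithmic cost criterion (every value handled is charged its
   bit length), so that running times agree up to a polynomial with those of
   Turing machines.  Besides the input [n], the only data available to a
   program are its own numeric constants and the binary digits of the fixed
   real [p], which it queries one at a time through [Digit]. *)

Inductive binop := Add | Sub | Mul | Div | Mod | Lt | Eq.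

Inductive expr :=
| Const of nat
| Reg of nat
| Read of expr
| Digit of expr
| Op of binop & expr & expr.

Inductive com :=
| Skip
| Assign of nat & expr
| Write of expr & expr
| Seq of com & com
| If of expr & com & com
| While of expr & com.

Record state := State { reg : nat -> nat; mem : nat -> nat }.

(* [Sub] is truncated, and [Div] and [Mod] by zero return 0 and the dividend. *)
Definition eval_op (o : binop) (a b : nat) : nat :=
  match o with
  | Add => (a + b)%N
  | Sub => (a - b)%N
  | Mul => (a * b)%N
  | Div => (a %/ b)%N
  | Mod => (a %% b)%N
  | Lt => nat_of_bool (a < b)%N
  | Eq => nat_of_bool (a == b)
  end.

Fixpoint eval (dig : nat -> bool) (s : state) (e : expr) : nat :=
  match e with
  | Const c => c
  | Reg i => reg s i
  | Read a => mem s (eval dig s a)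
  | Digit a => nat_of_bool (dig (eval dig s a))
  | Op o a b => eval_op o (eval dig s a) (eval dig s b)
  end.

Definition bitlen (v : nat) : nat := (trunc_log 2 v).+1.

Fixpoint ecost (dig : nat -> bool) (s : state) (e : expr) : nat :=
  (bitlen (eval dig s e) +
   match e with
   | Const _ | Reg _ => 0
   | Read a | Digit a => ecost dig s a
   | Op _ a b => ecost dig s a + ecost dig s b
   end)%N.

Definition set_reg (s : state) (i v : nat) : state :=
  State [eta reg s with i |-> v] (mem s).

Definition set_mem (s : state) (a v : nat) : state :=
  State (reg s) [eta mem s with a |-> v].

(* [exec dig c s t s']: started in state [s], the program [c] halts in state
   [s'] after time [t]. *)
Inductive exec (dig : nat -> bool) : com -> state -> nat -> state -> Prop :=
| exec_skip s : exec dig Skip s 1 s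
| exec_assign s i e :
    exec dig (Assign i e) s (ecost dig s e).+1 (set_reg s i (eval dig s e))
| exec_write s a e :
    exec dig (Write a e) s (ecost dig s a + ecost dig s e).+1
      (set_mem s (eval dig s a) (eval dig s e))
| exec_seq c1 c2 s1 s2 s3 t1 t2 :
    exec dig c1 s1 t1 s2 -> exec dig c2 s2 t2 s3 ->
    exec dig (Seq c1 c2) s1 (t1 + t2) s3
| exec_if_true e c1 c2 s s' t :
    eval dig s e != 0%N -> exec dig c1 s t s' ->
    exec dig (If e c1 c2) s (ecost dig s e + t).+1 s'
| exec_if_false e c1 c2 s s' t :
    eval dig s e = 0%N -> exec dig c2 s t s' ->
    exec dig (If e c1 c2) s (ecost dig s e + t).+1 s'
| exec_while_true e c s1 s2 s3 t1 t2 :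
    eval dig s1 e != 0%N -> exec dig c s1 t1 s2 ->
    exec dig (While e c) s2 t2 s3 ->
    exec dig (While e c) s1 (ecost dig s1 e + t1 + t2).+1 s3
| exec_while_false e c s :
    eval dig s e = 0%N -> exec dig (While e c) s (ecost dig s e).+1 s.

Lemma exec_det dig c s t1 s1 t2 s2 :
  exec dig c s t1 s1 -> exec dig c s t2 s2 -> t1 = t2 /\ s1 = s2.
Proof.
move=> H; elim: H t2 s2 => {c s t1 s1}.
- by move=> s t2 s2 H; inversion H.
- by move=> s i e t2 s2 H; inversion H.
- by move=> s a e t2 s2 H; inversion H.
- move=> c1 c2 sa sb sc ta tb _ IH1 _ IH2 t s H.
  inversion H as [| | |? ? ? s' ? ? ? h1 h2| | | |]; subst.
  by have [-> E] := IH1 _ _ h1; subst s'; have [-> ->] := IH2 _ _ h2.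
- move=> e c1 c2 s s' t ne _ IH t' s'' H.
  inversion H as [| | | |? ? ? ? ? ? _ h|? ? ? ? ? ? e0 _| |]; subst.
    by have [-> ->] := IH _ _ h.
  by rewrite e0 in ne.
- move=> e c1 c2 s s' t e0 _ IH t' s'' H.
  inversion H as [| | | |? ? ? ? ? ? ne _|? ? ? ? ? ? _ h| |]; subst.
    by rewrite e0 in ne.
  by have [-> ->] := IH _ _ h.
- move=> e c sa sb sc ta tb ne _ IH1 _ IH2 t s H.
  inversion H as [| | | | | |? ? ? s' ? ? ? _ h1 h2|? ? ? e0]; subst.
    by have [-> E] := IH1 _ _ h1; subst s'; have [-> ->] := IH2 _ _ h2.
  by rewrite e0 in ne.
- move=> e c s e0 t s' H.
  inversion H as [| | | | | |? ? ? ? ? ? ? ne _ _|]; subst => //.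
  by rewrite e0 in ne.
Qed.

(* [binary_digit p k] is the digit of weight [2 ^ - k] of [p >= 0]. *)
Definition binary_digit (R : realType) (p : R) (k : nat) : bool :=
  odd (Num.truncn (p * 2 ^+ k)).

Definition init_state (n : nat) : state :=
  State (fun i => if i == 0%N then n else 0%N) (fun=> 0%N).

(* The output is [m] in register 0, and in memory the entries of [A] in
   row-major order, each as a triple [a, b, d] standing for [(a - b) / d]. *)
Definition outputs (R : realType) (m n : nat) (s : state) (A : 'M[R]_(m, n)) :
    Prop :=
  reg s 0 = m /\
  forall (i : 'I_m) (j : 'I_n),
    let k := (3 * (i * n + j))%N in
    (0 < mem s k.+2)%N /\
    A i j = ((mem s k)%:R - (mem s k.+1)%:R) / (mem s k.+2)%:R.

Definition computes (R : realType) (p : R) (prog : com) (m n : nat)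
    (A : 'M[R]_(m, n)) (t : nat) : Prop :=
  exists s, exec (binary_digit p) prog (init_state n) t s /\ outputs s A.

(* Main.v *)
Require Import Defs.
From mathcomp Require Import all_boot all_order all_algebra.
From mathcomp Require Import all_classical all_reals all_analysis.
From mathcomp Require Import zify ring lra.

(* Let [S = \sum_j x_j eps_j F(u_j)], with signs [eps_j] and uniform [u_j] in
   [0, Q), where [F u] is of order [(Q / u) ^ (1 / p)], cut off at [u] of order
   [c >= n].  Pairwise independence within each of the two families, and
   independence between them, is enough for [E |S|] to be of order [|x|_p]; so
   [u_j = (a + b j) mod Q], with the signs read off [(a' + b' j) mod Q], give
   [m = Q ^ 4] rows, with [Q] of order [n ^ 2].

   Normalize [|x|_p = 1].  From above, coordinates with [|x_j F(u_j)| > 1] are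
   bounded in first moment and the others in second moment, where the signs are
   uncorrelated; both give [O(\sum_j |x_j| ^ p)] because [1 < p < 2].  From
   below, multiplying [S] by [eps_i] shows that the mean over the signs is at
   least every [|x_i| F(u_i)], and by a second moment argument some
   [u_i < Q |x_i| ^ p] with constant probability.

   Only the order of magnitude of [F] matters, so its values are powers of two
   and [p] is only needed to within [1 / Q]. *)

Set Implicit Arguments.
Unset Strict Implicit.
Unset Printing Implicit Defensive.

Import Order.TTheory GRing.Theory Num.Theory.
(* [mem], [eval] and others are shadowed by the MathComp imports. *)
Import Defs.

Local Open Scope ring_scope.

(** * Step counting *)

Local Open Scope nat_scope.

Fixpoint mulfree (e : expr) : bool :=
  match e with
  | Const _ | Reg _ => true
  | Read a | Digit a => mulfree a
  | Op o a b => (if o is Mul then false else true) && mulfree a && mulfree b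
  end.

(** A constant counts with its value instead of its bit length. This is crude, but one measure then
    bounds both the number of nodes and the number of bits by which an expression can exceed the
    stored values. *)
Fixpoint esize (e : expr) : nat :=
  match e with
  | Const c => c.+1
  | Reg _ => 1
  | Read a | Digit a => (esize a).+1
  | Op _ a b => (esize a + esize b).+1
  end.

Definition bounded (s : state) (B : nat) : Prop :=
  (forall i, reg s i < 2 ^ B) /\ (forall a, mem s a < 2 ^ B).

Lemma bounded_leq s B B' : B <= B' -> bounded s B -> bounded s B'.
Proof.
move=> h [h1 h2]; have le : 2 ^ B <= 2 ^ B' by rewrite leq_exp2l.
by split=> i; apply: leq_trans le.
Qed.

Lemma esize_gt0 e : 0 < esize e. Proof. by case: e. Qed.

(** An addition gains at most one bit over its longer operand, [Sub], [Div] and [Mod] never exceed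
    their first operand, and a read returns a stored value whatever its address. *)
Lemma eval_bounded dig s B e : mulfree e -> bounded s B ->
  eval dig s e < 2 ^ (B + esize e).
Proof.
move=> + [hr hm].
have up v k : v < 2 ^ B -> v < 2 ^ (B + k).
  by move=> h; apply: leq_trans h _; rewrite leq_exp2l // leq_addr.
have one k : 0 < k -> 1 < 2 ^ (B + k).
  by move=> k0; rewrite -{1}(expn0 2) ltn_exp2l //; lia.
elim: e => [c|i|a IH|a IH|o a IHa b IHb] /=; try by move=> *; apply: up.
- move=> _; apply: leq_trans (ltn_expl c (ltnSn 1)) _.
  by rewrite leq_exp2l //; lia.
- by move=> _; apply: leq_ltn_trans (leq_b1 _) (one _ _).
move=> /andP[/andP[ho /IHa ha /IHb hb]].
have {}ha : eval dig s a < 2 ^ (B + (esize a + esize b)).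
  by apply: leq_trans ha _; rewrite leq_exp2l //; lia.
have {}hb : eval dig s b < 2 ^ (B + (esize a + esize b)).
  by apply: leq_trans hb _; rewrite leq_exp2l //; lia.
have bit (x : bool) : x < 2 ^ (B + (esize a + esize b).+1).
  by apply: leq_ltn_trans (leq_b1 _) (one _ _).
move: ha hb; rewrite addnS expnS.
case: o ho => //= _ ha hb; try by rewrite -expnS -addnS; apply: bit.
- by lia.
- by lia.
- by have := leq_div (eval dig s a) (eval dig s b); lia.
- by have := leq_mod (eval dig s a) (eval dig s b); lia.
Qed.

Lemma bitlen_leq v k : 0 < k -> v < 2 ^ k -> bitlen v <= k.
Proof.
move=> k0 hv; rewrite /bitlen.
case: (posnP v) => [->|v0]; first by rewrite trunc_log0.
have := trunc_logP (ltnSn 1) v0 => h.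
by have := leq_ltn_trans h hv; rewrite ltn_exp2l.
Qed.

Lemma ecost_bounded dig s B e : mulfree e -> bounded s B ->
  ecost dig s e <= esize e * (B + esize e).
Proof.
move=> mf hB.
have hb e' : mulfree e' -> bitlen (eval dig s e') <= B + esize e'.
  move=> mf'; apply: bitlen_leq; last exact: eval_bounded.
  by have := esize_gt0 e'; lia.
elim: e mf => [c|i|a IH|a IH|o a IHa b IHb] mf.
- by have := hb _ mf; rewrite /ecost addn0 => h; apply: leq_trans h _; rewrite leq_pmull.
- by have := hb _ mf; rewrite /ecost addn0 => h; apply: leq_trans h _; rewrite leq_pmull.
- by have := hb _ mf; have := IH mf; rewrite /=; set u := bitlen _; nia.
- by have := hb _ mf; have := IH mf; rewrite /=; set u := bitlen _; nia.
have := hb _ mf; move: mf; rewrite /= => /andP[/andP[_ /IHa ha] /IHb hb'].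
move: ha hb'; set u := bitlen _; set x := ecost _ _ _; set y := ecost _ _ _.
by nia.
Qed.

(* Without [Mul] each step lengthens the largest value by boundedly many bits,
   so a bound [N] on the number of steps bounds the logarithmic cost by
   [N * (B + N)]. *)
Definition runs (dig : nat -> bool) (c : com) (s : state) (N : nat)
    (s' : state) : Prop :=
  forall B, bounded s B ->
    bounded s' (B + N) /\ exists2 t, exec dig c s t s' & t <= N * (B + N).

Lemma runs_leq dig c s N N' s' : N <= N' -> runs dig c s N s' ->
  runs dig c s N' s'.
Proof.
move=> h H B /H[b' [t ht le]]; split; first by apply: bounded_leq b'; lia.
by exists t => //; apply: leq_trans le _; apply: leq_mul => //; lia.
Qed.

Lemma runs_assign dig s i e : mulfree e ->
  runs dig (Assign i e) s (esize e).+1 (set_reg s i (eval dig s e)).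
Proof.
move=> mf B hB; split.
  case: (hB) => hr hm; have le : 2 ^ B <= 2 ^ (B + (esize e).+1).
    by rewrite leq_exp2l //; lia.
  split=> [j|a] /=; last exact: leq_trans (hm a) le.
  case: ifP => _; last exact: leq_trans (hr j) le.
  by apply: leq_trans (eval_bounded dig mf hB) _; rewrite leq_exp2l //; lia.
exists (ecost dig s e).+1; first exact: exec_assign.
by have := ecost_bounded dig mf hB; nia.
Qed.

Lemma runs_write dig s a e : mulfree a -> mulfree e ->
  runs dig (Write a e) s (esize a + esize e).+1
    (set_mem s (eval dig s a) (eval dig s e)).
Proof.
move=> mfa mf B hB; split.
  case: (hB) => hr hm; have le : 2 ^ B <= 2 ^ (B + (esize a + esize e).+1).
    by rewrite leq_exp2l //; lia.
  split=> [j|j] /=; first exact: leq_trans (hr j) le.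
  case: ifP => _; last exact: leq_trans (hm j) le.
  by apply: leq_trans (eval_bounded dig mf hB) _; rewrite leq_exp2l //; lia.
exists (ecost dig s a + ecost dig s e).+1; first exact: exec_write.
by have := ecost_bounded dig mf hB; have := ecost_bounded dig mfa hB; nia.
Qed.

Lemma runs_seq dig c1 c2 s1 s2 s3 N1 N2 : runs dig c1 s1 N1 s2 ->
  runs dig c2 s2 N2 s3 -> runs dig (Seq c1 c2) s1 (N1 + N2) s3.
Proof.
move=> H1 H2 B /H1[/H2[b3 [t2 e2 l2]] [t1 e1 l1]].
split; first by rewrite addnA.
by exists (t1 + t2); [exact: exec_seq e1 e2|nia].
Qed.

(** The family [f] gives the exact state before each iteration and so replaces a loop invariant. The
    induction peels off the first iteration and shifts [f]. *)
Lemma runs_while dig e c (f : nat -> state) k N : mulfree e ->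
  (forall t, t < k -> eval dig (f t) e != 0) ->
  (forall t, t < k -> runs dig c (f t) N (f t.+1)) ->
  eval dig (f k) e = 0 ->
  runs dig (While e c) (f 0) (k.+1 * (esize e + N).+1) (f k).
Proof.
move=> mf; elim: k f => [|k IH] f hne hc h0.
  apply: (@runs_leq _ _ _ (esize e).+1); first by lia.
  move=> B hB; split; first by apply: bounded_leq hB; lia.
  exists (ecost dig (f 0) e).+1; first exact: exec_while_false.
  by have := ecost_bounded dig mf hB; nia.
have {}IH := IH (f \o succn) (fun t => hne t.+1) (fun t => hc t.+1) h0.
have {}hc := hc 0 (ltn0Sn _); have {}hne := hne 0 (ltn0Sn _).
move=> B hB; have [b1 [t1 e1 l1]] := hc B hB.
have [b2 [t2 e2 l2]] := IH _ b1.
split; first by apply: bounded_leq b2; nia.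
exists (ecost dig (f 0) e + t1 + t2).+1; first exact: exec_while_true e1 e2.
have := ecost_bounded dig mf hB.
move: l1 l2; move: (ecost _ _ _) (esize e) => x sz; set N2 := k.+1 * _.
rewrite (_ : k.+2 * _ = (sz + N).+1 + N2); last by rewrite mulSn.
by nia.
Qed.

(* With the registers as an explicit list, straight-line code is evaluated by
   computation. *)
Definition St (l : seq nat) (m : nat -> nat) : state := State (nth 0 l) m.

Lemma set_regE l m i v : set_reg (St l m) i v = St (set_nth 0 l i v) m.
Proof.
rewrite /set_reg /St /=; congr State; apply/funext => j /=.
by rewrite nth_set_nth.
Qed.

Local Open Scope ring_scope.

(** * Affine hashing and signs *)

Lemma sum_blocks (V : nmodType) (f : nat -> V) (M K : nat) :
  \sum_(y < M * K) f y = \sum_(b < M) \sum_(e < K) f (b * K + e)%N.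
Proof.
elim: M => [|M IH]; first by rewrite mul0n !big_ord0.
by rewrite mulSnr big_split_ord IH big_ord_recr.
Qed.

Lemma sum_shift (V : nmodType) (f : nat -> V) (Q t : nat) :
  \sum_(a < Q) f ((a + t) %% Q)%N = \sum_(a < Q) f a.
Proof.
case: Q => [|Q]; first by rewrite !big_ord0.
have inj : injective (fun a : 'I_Q.+1 => inord ((a + t) %% Q.+1) : 'I_Q.+1).
  move=> a b /(congr1 val); rewrite /= !inordK ?ltn_mod // => /eqP.
  by rewrite eqn_modDr !modn_small // => /eqP/val_inj.
rewrite [RHS](reindex_inj inj); apply: eq_bigr => a _.
by rewrite inordK ?ltn_mod.
Qed.

(** For every fixed [b], the shift by [a] alone already makes the residue uniform. *)
Lemma sum_affine (V : nmodType) (f : nat -> V) (Q i : nat) :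
  \sum_(a < Q) \sum_(b < Q) f ((a + b * i) %% Q)%N = (\sum_(u < Q) f u) *+ Q.
Proof.
rewrite exchange_big /= (eq_bigr (fun=> \sum_(u < Q) f u)).
  by rewrite sumr_const card_ord.
by move=> b _; rewrite sum_shift.
Qed.

(* Each hit [x %% Q < th] of the progression [x = a + b * d] yields [d]
   consecutive integers with residue below [th + d], and these blocks tile [d]
   full periods. *)
Lemma count_progression (a d Q th : nat) : (0 < d)%N ->
  (\sum_(b < Q) ((a + b * d) %% Q < th) <= th + d)%N.
Proof.
move=> d0; case: (posnP Q) => [->|Q0]; first by rewrite big_ord0.
rewrite -(leq_pmul2r d0) big_distrl /=.
apply: (@leq_trans (\sum_(b < Q) \sum_(e < d)
    ((a + (b * d + e)) %% Q < th + d)%N)).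
  apply: leq_sum => b _; case: ltnP => // h; rewrite mul1n.
  rewrite -[X in (X <= _)%N]card_ord -sum1_card leq_sum // => e _.
  rewrite addnA -modnDml.
  have := leq_mod ((a + b * d) %% Q + e) Q; have := ltn_ord e.
  by move: h; case: ltnP => //; lia.
have /= <- := sum_blocks (V := nat)
  (fun y => ((a + y) %% Q < th + d)%N : nat) Q d.
have E := sum_blocks (V := nat)
  (fun y => ((a + y) %% Q < th + d)%N : nat) d Q.
rewrite mulnC; apply: leq_trans (eq_leq E) _.
apply: (@leq_trans (\sum_(k < d) (th + d)%N)%N); last first.
  by rewrite sum_nat_const card_ord mulnC.
apply: leq_sum => k _.
rewrite (eq_bigr (fun e : 'I_Q => ((e + a) %% Q < th + d)%N : nat)); last first.
  by move=> e _; rewrite addnCA modnMDl addnC.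
have /= -> := sum_shift (V := nat) (fun u => (u < th + d)%N : nat) Q a.
rewrite -big_mkcond /= -(big_mkord (fun u => u < th + d)%N (fun=> 1%N)).
rewrite sum1_count; elim: Q {Q0 E} => [|Q IH] //.
rewrite /index_iota subn0 in IH; rewrite /index_iota subn0
  -(addn1 Q) iotaD count_cat /= add0n addn0.
case: (ltnP Q (th + d)) => h; last by rewrite addn0.
have := count_size (fun u => u < th + d)%N (iota 0 Q).
by rewrite size_iota /=; lia.
Qed.

Section Signs.
Variable R : realType.

Definition hsign (Q v : nat) : R := if (v + v < Q)%N then 1 else -1.

Lemma hsign_sqr Q v : hsign Q v * hsign Q v = 1.
Proof. by rewrite /hsign; case: ifP => _; ring. Qed.

Lemma normr_hsign Q v : `|hsign Q v| = 1.
Proof. by rewrite /hsign; case: ifP => _; rewrite ?normrN normr1. Qed.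

Lemma hsign_half h v : (0 < h)%N ->
  hsign (h + h) ((v + h) %% (h + h)) = - hsign (h + h) (v %% (h + h)).
Proof.
move=> h0; rewrite -modnDml /hsign.
have : (v %% (h + h) < h + h)%N by rewrite ltn_mod; lia.
move: (v %% _)%N => w hw; case: (ltnP (w + w) (h + h)) => hw2.
  by rewrite modn_small ?(ifF _ _ (_ : (_ < _)%N = false)) //; lia.
have -> : ((w + h) %% (h + h) = w - h)%N.
  have -> : (w + h = (w - h) + (h + h))%N by lia.
  by rewrite modnDr modn_small; lia.
by rewrite opprK ifT //; lia.
Qed.

(* [d = 2 ^ z * odd] with [z < D.+1], so [b0 = 2 ^ (D - z)] satisfies
   [b0 * d = 2 ^ D] modulo [2 ^ D.+1]. *)
Lemma half_period (D d : nat) : (0 < d < 2 ^ D)%N ->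
  exists b0 : nat, (b0 * d = 2 ^ D %[mod 2 ^ D.+1])%N.
Proof.
case/andP=> d0 dD; have [m mo dE] := pfactor_coprime (isT : prime 2) d0.
have zD : (logn 2 d < D)%N.
  rewrite -(ltn_exp2l _ _ (ltnSn 1)); apply: leq_ltn_trans dD.
  by rewrite {2}dE leq_pmull //; case: m mo dE => // _; lia.
exists (2 ^ (D - logn 2 d))%N; rewrite {2}dE mulnCA -expnD subnK ?(ltnW zD) //.
have mm : odd m by rewrite -coprime2n.
rewrite -(odd_double_half m) mm mulnDl mul1n addnC -muln2 -mulnA -expnS.
by rewrite modnMDl.
Qed.

(** Shifting [b] by the [b0] of [half_period] moves every argument by half of the modulus and flips
    every sign, so the sum equals its own negative. *)
Lemma hsign_sum0 D a d : (0 < d < 2 ^ D)%N ->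
  \sum_(b < 2 ^ D.+1) hsign (2 ^ D.+1) ((a + b * d) %% 2 ^ D.+1) = 0.
Proof.
move=> hd; have [b0 hb0] := half_period hd.
set Q := (2 ^ D.+1)%N in hb0 *.
have QE : Q = (2 ^ D + 2 ^ D)%N by rewrite /Q expnS mul2n addnn.
set S := \sum_(b < Q) _; suff : S = - S by lra.
rewrite {1}/S -sumrN.
rewrite -(sum_shift (fun b => hsign Q ((a + b * d) %% Q)) Q b0).
apply: eq_bigr => b _; rewrite -modnDmr modnMml modnDmr mulnDl addnA -modnDmr hb0.
move: (a + b * d)%N => v.
by rewrite modnDmr QE hsign_half // expn_gt0.
Qed.

(** Substituting [a + b * i] for [a] leaves [b] in the second factor only, with step [j - i], and
    there [hsign_sum0] applies. *)
Lemma hsign_orthogonal_lt D i j : (i < j < 2 ^ D)%N ->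
  \sum_(a < 2 ^ D.+1) \sum_(b < 2 ^ D.+1)
    hsign (2 ^ D.+1) ((a + b * i) %% 2 ^ D.+1) *
    hsign (2 ^ D.+1) ((a + b * j) %% 2 ^ D.+1) = 0.
Proof.
move=> /andP[ij jD]; set Q := (2 ^ D.+1)%N.
rewrite exchange_big /=.
transitivity (\sum_(b < Q) \sum_(a < Q)
    hsign Q a * hsign Q ((a + b * (j - i)) %% Q)).
  apply: eq_bigr => b _.
  rewrite -(sum_shift (fun a => hsign Q a * hsign Q ((a + b * (j - i)) %% Q))
    Q (b * i)).
  apply: eq_bigr => a _; rewrite modnDml -addnA -mulnDr subnKC //; exact: ltnW.
rewrite exchange_big big1 // => a _.
by rewrite -mulr_sumr hsign_sum0 ?mulr0 //; lia.
Qed.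

Lemma hsign_orthogonal D i j : (i < 2 ^ D)%N -> (j < 2 ^ D)%N ->
  \sum_(a < 2 ^ D.+1) \sum_(b < 2 ^ D.+1)
    hsign (2 ^ D.+1) ((a + b * i) %% 2 ^ D.+1) *
    hsign (2 ^ D.+1) ((a + b * j) %% 2 ^ D.+1) =
  (i == j)%:R * (2 ^ D.+1)%:R ^+ 2.
Proof.
move=> iD jD; case: (ltngtP i j) => [ij|ji|->].
- by rewrite mul0r hsign_orthogonal_lt // ij.
- rewrite mul0r -[RHS](@hsign_orthogonal_lt D j i) ?ji //.
  by apply: eq_bigr => a _; apply: eq_bigr => b _; rewrite mulrC.
rewrite mul1r (eq_bigr (fun=> (2 ^ D.+1)%:R)) => [|a _].
  by rewrite sumr_const card_ord expr2 mulr_natr.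
rewrite (eq_bigr (fun=> 1)) => [|b _]; last exact: hsign_sqr.
by rewrite sumr_const card_ord.
Qed.

Section Combination.
Variables (n D : nat) (y : 'I_n -> R).
Hypothesis nD : (n <= 2 ^ D)%N.
Let Q := (2 ^ D.+1)%N.
Let eps (a b : nat) (i : 'I_n) : R := hsign Q ((a + b * i) %% Q).

Let eps_orth (i j : 'I_n) :
  \sum_(a < Q) \sum_(b < Q) eps a b i * eps a b j = (i == j)%:R * Q%:R ^+ 2.
Proof.
by rewrite hsign_orthogonal //; apply: leq_trans (ltn_ord _) nD.
Qed.

Lemma sum_eps_mul (j : 'I_n) :
  \sum_(a < Q) \sum_(b < Q) (\sum_i y i * eps a b i) * eps a b j =
  y j * Q%:R ^+ 2.
Proof.
transitivity (\sum_i y i * \sum_(a < Q) \sum_(b < Q) eps a b i * eps a b j).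
  under eq_bigr do under eq_bigr do rewrite mulr_suml.
  under eq_bigr do rewrite exchange_big /=.
  rewrite exchange_big /=; apply: eq_bigr => i _; rewrite mulr_sumr.
  apply: eq_bigr => a _; rewrite mulr_sumr; apply: eq_bigr => b _.
  by rewrite mulrA.
rewrite (bigD1 j) //= eps_orth eqxx mul1r big1 ?addr0 // => i /negbTE ij.
by rewrite eps_orth ij mul0r mulr0.
Qed.

(** Parseval's identity for the orthogonal signs: [sum_eps_mul] weighted by [y j] and summed over
    [j]. *)
Lemma sum_eps_sqr :
  \sum_(a < Q) \sum_(b < Q) (\sum_i y i * eps a b i) ^+ 2 =
  (\sum_i y i ^+ 2) * Q%:R ^+ 2.
Proof.
rewrite mulr_suml.
under [RHS]eq_bigr => i _ do rewrite expr2 -mulrA -sum_eps_mul mulr_sumr.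
rewrite [RHS]exchange_big /=; apply: eq_bigr => a _.
under [RHS]eq_bigr => i _ do rewrite mulr_sumr.
rewrite [RHS]exchange_big /=; apply: eq_bigr => b _.
rewrite expr2 mulr_suml; apply: eq_bigr => i _; ring.
Qed.

(** Correlating the sum with the sign of index [j] isolates [y j], and a sign does not change
    absolute values. *)
Lemma le_norm_sum_eps (j : 'I_n) :
  `|y j| * Q%:R ^+ 2 <= \sum_(a < Q) \sum_(b < Q) `|\sum_i y i * eps a b i|.
Proof.
have -> : `|y j| * Q%:R ^+ 2 = `|y j * Q%:R ^+ 2|.
  by rewrite normrM [ `|Q%:R ^+ 2|]ger0_norm ?exprn_ge0.
rewrite -sum_eps_mul; apply: le_trans (ler_norm_sum _ _ _) _.
apply: ler_sum => a _; apply: le_trans (ler_norm_sum _ _ _) _.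
by apply: ler_sum => b _; rewrite normrM normr_hsign mulr1.
Qed.

End Combination.

(* Coordinates above [1] are bounded in first moment, the others in second. *)
Lemma norm_sum_eps_le n D (y : 'I_n -> R) : (n <= 2 ^ D)%N ->
  \sum_(a < 2 ^ D.+1) \sum_(b < 2 ^ D.+1)
    `|\sum_i y i * hsign (2 ^ D.+1) ((a + b * i) %% 2 ^ D.+1)| <=
  (1 + \sum_i Num.min `|y i| (y i ^+ 2)) * (2 ^ D.+1)%:R ^+ 2.
Proof.
move=> nD; set Q := (2 ^ D.+1)%N.
pose eps (a b : nat) (i : 'I_n) : R := hsign Q ((a + b * i) %% Q).
pose z i := if `|y i| <= 1 then y i else 0.
have pt (a b : nat) : `|\sum_i y i * eps a b i| <=
    \sum_i `|y i - z i| + (1 + (\sum_i z i * eps a b i) ^+ 2) / 2.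
  have -> : \sum_i y i * eps a b i =
      \sum_i (y i - z i) * eps a b i + \sum_i z i * eps a b i.
    by rewrite -big_split /=; apply: eq_bigr => i _; ring.
  apply: le_trans (ler_normD _ _) _; apply: lerD.
    apply: le_trans (ler_norm_sum _ _ _) _; apply: ler_sum => i _.
    by rewrite normrM normr_hsign mulr1.
  (* The inequality [t <= (1 + t ^+ 2) / 2] takes the place of Cauchy-Schwarz in passing from first
     to second moments. *)
  rewrite -real_normK ?num_real //; set t := `|_|.
  have := sqr_ge0 (t - 1); nra.
apply: (@le_trans _ _ (\sum_(a < Q) \sum_(b < Q)
    (\sum_i `|y i - z i| + (1 + (\sum_i z i * eps a b i) ^+ 2) / 2))).
  by apply: ler_sum => a _; apply: ler_sum => b _; apply: pt.
have -> : \sum_(a < Q) \sum_(b < Q)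
    (\sum_i `|y i - z i| + (1 + (\sum_i z i * eps a b i) ^+ 2) / 2) =
  (\sum_i `|y i - z i| + (1 + \sum_i z i ^+ 2) / 2) * Q%:R ^+ 2.
  transitivity (\sum_(a < Q) \sum_(b < Q) (\sum_i `|y i - z i| + 2^-1) +
     (\sum_(a < Q) \sum_(b < Q) (\sum_i z i * eps a b i) ^+ 2) / 2).
    rewrite mulr_suml -big_split /=; apply: eq_bigr => a _.
    rewrite mulr_suml -big_split /=; apply: eq_bigr => b _.
    by rewrite mulrDl mul1r addrA.
  rewrite (sum_eps_sqr z nD) -/Q.
  rewrite !sumr_const card_ord -mulrnA -(mulr_natr _ (Q * Q)) natrM.
  move: (\sum_i `|_|) (\sum_i _ ^+ 2) (Q%:R) => u v q; by field.
rewrite ler_wpM2r ?exprn_ge0 //.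
suff : \sum_i `|y i - z i| + (\sum_i z i ^+ 2) / 2 <=
    \sum_i Num.min `|y i| (y i ^+ 2) by lra.
rewrite mulr_suml -big_split /=; apply: ler_sum => i _; rewrite /z le_min.
rewrite -real_normK ?num_real // -(real_normK (num_real (y i))).
have := normr_ge0 (y i); case: ifPn.
  by rewrite subrr normr0; set t := `|y i| => *; apply/andP; split; nra.
by rewrite -ltNge subr0 normr0; set t := `|y i| => *; apply/andP; split; nra.
Qed.

End Signs.

(** * Moment bounds *)

Section PowerSums.
Variable R : realType.
Implicit Types x y g : R.

(** The tangent of a concave power at [y] lies above its graph. Young's inequality for the powers of
    [x] and [y] with exponents [g] and [1 - g] gives this after multiplication by the power [g - 1]
    of [y]. The case [x = 0] starts the telescoping in [sum_powRN_le]. *)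
Lemma powR_concave_step x y g : 0 <= x -> 0 < y -> 0 < g < 1 ->
  x `^ g + g * (y - x) * y `^ (g - 1) <= y `^ g.
Proof.
move=> x0 y0 /andP[g0 g1].
have h0 : 0 < 1 - g by lra.
have := @conjugate_powR R (x `^ g) (y `^ (1 - g)) g^-1 (1 - g)^-1
  (powR_ge0 _ _) (powR_ge0 _ _).
rewrite !invr_gt0 !invrK => /(_ g0 h0 (subrKC _ _)).
rewrite -!powRrM !mulfV ?gt_eqF // !powRr1 ?(ltW y0) // => h.
have yy : y `^ (1 - g) * y `^ (g - 1) = 1.
  by rewrite -powRD ?(gt_eqF y0) ?implybT // addrC addrA subrK subrr powRr0.
have yg : y * y `^ (g - 1) = y `^ g by rewrite mulr_powRB1 // ltW.
have := ler_wpM2r (powR_ge0 y (g - 1)) h.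
rewrite -(mulrA (x `^ g)) yy mulr1; move: yg; set w := y `^ (g - 1).
move=> <- ; lra.
Qed.

(** The tangent of a convex power lies below its graph. Scaling reduces this to the ratio
    [r = x / y], where [1 + t <= expR t] and [ln r <= r - 1] suffice. *)
Lemma powR_convex_step x y h : 0 < x -> 0 < y -> 0 < h ->
  y `^ (- h) + h * (y - x) * y `^ (- h - 1) <= x `^ (- h).
Proof.
move=> x0 y0 h0; have r0 : 0 < x / y by rewrite divr_gt0.
have -> : x `^ (- h) = y `^ (- h) * (x / y) `^ (- h).
  by rewrite -powRM ?ltW // mulrC divfK // gt_eqF.
have -> : y `^ (- h - 1) = y `^ (- h) / y.
  by rewrite powRB ?(gt_eqF y0) ?implybT // powRr1 // ltW.
rewrite (_ : _ + _ = y `^ (- h) * (1 + h * (1 - x / y))); last first.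
  by field; rewrite gt_eqF.
rewrite ler_wpM2l ?powR_ge0 // /powR gt_eqF //.
apply: le_trans (expR_ge1Dx _); rewrite lerD2l mulNr -mulrN ler_wpM2l ?(ltW h0) //.
have := @le_ln1Dx R (x / y - 1).
rewrite subrKC ltrBrDr addNr => /(_ r0) r1; lra.
Qed.

(** Comparison with the integral, carried out by telescoping: the concave tangent bounds each term
    by an increment of the right-hand side. *)
Lemma sum_powRN_le (a : R) (M : nat) : 0 < a < 1 ->
  \sum_(u < M) u.+1%:R `^ (- a) <= M%:R `^ (1 - a) / (1 - a).
Proof.
move=> /andP[a0 a1]; have b0 : 0 < 1 - a by lra.
elim: M => [|M IH]; first by rewrite big_ord0 powR0 ?mul0r // gt_eqF.
rewrite big_ord_recr /=; apply: le_trans (lerD IH (lexx _)) _.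
rewrite -(ler_pM2r b0) mulrDl !divfK ?gt_eqF //.
have := @powR_concave_step M%:R M.+1%:R (1 - a) (ler0n _ _) (ltr0Sn _ _).
move=> /(_ ltac:(lra)); rewrite (_ : 1 - a - 1 = - a); last by ring.
by rewrite -natr1 (addrC M%:R 1) addrK mulr1 mulrC (addrC 1).
Qed.

Lemma sum_powRN_tail_le (b : R) (M K : nat) : 1 < b -> (0 < M)%N ->
  \sum_(k < K) (M + k).+1%:R `^ (- b) <= M%:R `^ (1 - b) / (b - 1).
Proof.
move=> b1 M0; have h0 : 0 < b - 1 by lra.
(* The induction needs the negative end term of the telescoping sum, which is dropped afterwards. *)
suff : \sum_(k < K) (M + k).+1%:R `^ (- b) <=
    (M%:R `^ (1 - b) - (M + K)%:R `^ (1 - b)) / (b - 1).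
  move=> h; apply: le_trans h _; rewrite ler_pM2r ?invr_gt0 //.
  by rewrite gerBl powR_ge0.
elim: K => [|K IH]; first by rewrite big_ord0 addn0 subrr mul0r.
rewrite big_ord_recr /=; apply: le_trans (lerD IH (lexx _)) _.
rewrite -(ler_pM2r h0) mulrDl !divfK ?gt_eqF //.
have := @powR_convex_step (M + K)%:R (M + K).+1%:R (b - 1).
rewrite !ltr0n addn_gt0 M0 => /(_ isT isT h0).
rewrite (_ : - (b - 1) - 1 = - b); last by ring.
rewrite opprB -natr1 (addrC (M + K)%:R 1) addrK mulr1 nat1r -addnS => h; lra.
Qed.

Lemma powR_le_self (x a : R) : 0 <= x <= 1 -> 1 <= a -> x `^ a <= x.
Proof.
case/andP; rewrite le_eqVlt => /predU1P[<- _ a1|x0 x1 a1].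
  by rewrite powR0 // gt_eqF //; lra.
by apply: ge1r_powR => //; rewrite x0.
Qed.

Lemma powR_sqr (x a : R) : (x `^ a) ^+ 2 = x `^ (2 * a).
Proof. by rewrite mulrC powRrM powR_mulrn ?powR_ge0. Qed.

(* Splitting the sum at [u = th]: both halves are of order [th] because
   [a < 1 < 2 * a]. *)
Lemma sum_min_powR_le (a th : R) (Q : nat) : 2^-1 < a < 1 -> 0 <= th ->
  \sum_(u < Q) Num.min ((th / u.+1%:R) `^ a) (((th / u.+1%:R) `^ a) ^+ 2) <=
  ((1 - a)^-1 + 2 / (2 * a - 1)) * th.
Proof.
move=> /andP[a2 a1]; rewrite le_eqVlt => /predU1P[<-|th0].
  rewrite big1 ?mulr0 // => u _; rewrite mul0r powR0 ?minEle ?expr0n /= ?lexx //.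
  by rewrite gt_eqF //; lra.
pose f (u : nat) : R :=
  Num.min ((th / u.+1%:R) `^ a) (((th / u.+1%:R) `^ a) ^+ 2).
rewrite -/(\sum_(u < Q) f u); pose M := maxn 1 (Num.truncn th).
have f0 u : 0 <= f u by rewrite le_min powR_ge0 exprn_ge0 ?powR_ge0.
have sqrE u : ((th / u.+1%:R) `^ a) ^+ 2 = th `^ (2 * a) * u.+1%:R `^ (- (2 * a)).
  by rewrite powR_sqr powRM ?invr_ge0 ?ltW // -powR_inv1 // -powRrM mulN1r.
have pE u : (th / u.+1%:R) `^ a = th `^ a * u.+1%:R `^ (- a).
  by rewrite powRM ?invr_ge0 ?ltW // -powR_inv1 // -powRrM mulN1r.
have thM : th <= 2 * M%:R.
  have := truncnS_gt th; rewrite /M; case: (Num.truncn th) => [|k].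
    by rewrite maxn0; lra.
  by rewrite (maxn_idPr _) // -!natr1; have := ler0n R k; lra.
have M0 : (0 < M)%N by rewrite /M leq_max.
(* Extending the range of nonnegative terms allows the split at [M] even when [M] exceeds [Q]. *)
have : \sum_(u < Q) f u <= \sum_(u < M + Q) f u.
  rewrite addnC big_split_ord /= lerDl; exact: sumr_ge0.
move/le_trans; apply; rewrite big_split_ord /= mulrDl; apply: lerD.
  (* Below 1 the head is a single term, bounded by the second branch of the minimum. Otherwise
     [M <= th] and the first branch is summed. *)
  have [th1|th1] := ltP th 1.
    have ME : M = 1%N by rewrite /M (elimT (truncn0Pn th)) // -ltNge.
    rewrite ME big_ord_recl big_ord0 addr0 /= /f ge_min; apply/orP; right.
    rewrite divr1 powR_sqr; apply: (@le_trans _ _ th).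
      by apply: powR_le_self; lra.
    by rewrite ler_peMl ?(ltW th0) // invf_ge1; lra.
  have Mth : M%:R <= th.
    rewrite /M (maxn_idPr _); first by rewrite truncn_le ltW.
    by rewrite truncn_gt0.
  apply: (@le_trans _ _ (th `^ a * \sum_(u < M) u.+1%:R `^ (- a))).
    by rewrite mulr_sumr; apply: ler_sum => u _; rewrite /f ge_min pE lexx.
  have := @sum_powRN_le a M; rewrite a1 (_ : 0 < a); last by lra.
  move=> /(_ isT) h; apply: le_trans (ler_wpM2l (powR_ge0 _ _) h) _.
  have i0 : 0 <= (1 - a)^-1 by rewrite invr_ge0; lra.
  rewrite mulrA mulrC; apply: (ler_wpM2l i0).
  apply: (@le_trans _ _ (th `^ a * th `^ (1 - a))).
    rewrite ler_wpM2l ?powR_ge0 // ge0_ler_powR ?nnegrE ?(ltW th0) //; lra.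
  by rewrite -powRD ?(gt_eqF th0) ?implybT // subrKC powRr1 // ltW.
apply: (@le_trans _ _ (th `^ (2 * a) *
    \sum_(u < Q) (M + u).+1%:R `^ (- (2 * a)))).
  rewrite mulr_sumr; apply: ler_sum => u _.
  by rewrite /f ge_min -sqrE lexx orbT.
have h := @sum_powRN_tail_le (2 * a) M Q ltac:(lra) M0.
apply: le_trans (ler_wpM2l (powR_ge0 _ _) h) _.
have i0 : 0 <= (2 * a - 1)^-1 by rewrite invr_ge0; lra.
rewrite mulrA [leRHS]mulrAC; apply: (ler_wpM2r i0).
have MR : 0 < M%:R :> R by rewrite ltr0n.
rewrite (_ : 1 - 2 * a = - (2 * a - 1)) ?powRN; last by ring.
rewrite -mulr_powRB1 ?(ltW th0) //; last by lra.
rewrite -mulrA [leRHS]mulrC ler_wpM2l ?(ltW th0) //.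
rewrite ler_pdivrMr ?powR_gt0 //.
(* The factor 2 of the constant arises here, from [th <= 2 * M] and [2 * a - 1 <= 1]. *)
apply: (@le_trans _ _ ((2 * M%:R) `^ (2 * a - 1))).
  by rewrite ge0_ler_powR ?nnegrE ?(ltW th0) //; nra.
rewrite powRM ?ler0n // ler_wpM2r ?powR_ge0 //.
by apply: ler1_powR; lra.
Qed.

End PowerSums.

(** * Counting hash values below a threshold *)

Lemma sum_ltn (Q th : nat) : (th <= Q)%N -> (\sum_(u < Q) (u < th) = th)%N.
Proof.
move=> thQ; rewrite -(subnKC thQ) big_split_ord /= [X in (_ + X)%N]big1 => [|u _].
  rewrite addn0 (eq_bigr (fun=> 1%N)) => [|u _]; last by rewrite ltn_ord.
  by rewrite sum_nat_const card_ord muln1.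
by rewrite ltnNge leq_addr.
Qed.

Lemma count_single (Q i th : nat) :
  (\sum_(a < Q) \sum_(b < Q) ((a + b * i) %% Q < th) <= Q * th)%N.
Proof.
have /= := sum_affine (V := nat) (fun u => (u < th)%N : nat) Q i.
move=> E; apply: leq_trans (eq_leq E) _; rewrite -mulr_natl natn leq_mul2l.
apply/orP; right; case: (leqP th Q) => thQ; first by rewrite sum_ltn.
apply: leq_trans (ltnW thQ); rewrite -[leqRHS]card_ord -sum1_card.
by apply: leq_sum => u _; exact: leq_b1.
Qed.

(** Substituting [a + b * i] for [a] turns the first condition into [a < th] and the second into
    hits of a progression of step [j - i]. The excess [j - i] is the price of a modulus to which
    [j - i] need not be coprime. *)
Lemma count_pair_lt (Q i j th th' : nat) : (i < j)%N ->
  (\sum_(a < Q) \sum_(b < Q)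
     ((a + b * i) %% Q < th) && ((a + b * j) %% Q < th') <=
   th * (th' + (j - i)))%N.
Proof.
move=> ij; rewrite exchange_big /=.
have -> : (\sum_(b < Q) \sum_(a < Q)
     ((a + b * i) %% Q < th) && ((a + b * j) %% Q < th') =
   \sum_(b < Q) \sum_(a < Q) (a < th) && ((a + b * (j - i)) %% Q < th'))%N.
  apply: eq_bigr => b _.
  have /= <- := sum_shift (V := nat)
   (fun a => ((a < th) && ((a + b * (j - i)) %% Q < th'))%N : nat) Q (b * i).
  apply: eq_bigr => a _; congr (nat_of_bool (_ && (_ < _)%N)).
  by rewrite modnDml -addnA -mulnDr subnKC // ltnW.
rewrite exchange_big /=.
apply: (@leq_trans (\sum_(a < Q) (a < th) * (th' + (j - i)))%N).
  apply: leq_sum => a _; case: (a < th)%N; last by rewrite big1.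
  by rewrite mul1n; apply: count_progression; rewrite subn_gt0.
rewrite -big_distrl /= leq_mul2r; apply/orP; right.
case: (leqP th Q) => thQ; first by rewrite sum_ltn.
apply: leq_trans (ltnW thQ); rewrite -[leqRHS]card_ord -sum1_card.
by apply: leq_sum => u _; exact: leq_b1.
Qed.

(** A nonzero threshold is at least [c], hence larger than the distance of [i] and [j], so the
    factor 2 absorbs the excess in [count_pair_lt]. *)
Lemma count_pair (Q c i j th th' : nat) : i != j -> (i < c)%N -> (j < c)%N ->
  th = 0%N \/ (c <= th)%N -> th' = 0%N \/ (c <= th')%N ->
  (\sum_(a < Q) \sum_(b < Q)
     ((a + b * i) %% Q < th) && ((a + b * j) %% Q < th') <=
   2 * th * th')%N.
Proof.
move=> ij ic jc [->|ct] [->|ct'];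
  try by rewrite big1 // => a _; rewrite big1 // => b _; rewrite ltn0 ?andbF.
case: (ltngtP i j) ij => // ij _.
  apply: leq_trans (count_pair_lt _ _ _ ij) _.
  by rewrite mulnAC mulnC leq_mul2r; apply/orP; right; lia.
under eq_bigr do under eq_bigr do rewrite andbC.
apply: leq_trans (count_pair_lt _ _ _ ij) _.
by rewrite mulnC leq_mul2r; apply/orP; right; lia.
Qed.

(** * Upper and lower bounds for the mean of the row sums *)

Section Bounds.
Variables (R : realType) (p : R).
Hypotheses (hp1 : 1 < p) (hp2 : p < 2).

Let p0 : 0 < p. Proof. exact: lt_trans hp1. Qed.
Let pV : 2^-1 < p^-1 < 1.
Proof. by rewrite ltf_pV2 ?posrE // hp2 /= invf_lt1 // hp1. Qed.

(** The constant of [sum_min_powR_le] at [a = p^-1]. It blows up as [p] approaches 1 or 2. *)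
Definition upper_const : R := (1 - p^-1)^-1 + 2 / (2 * p^-1 - 1).

Lemma upper_const_ge0 : 0 <= upper_const.
Proof.
case/andP: pV => h1 h2; rewrite /upper_const addr_ge0 ?invr_ge0 //; first by lra.
by rewrite divr_ge0 //; lra.
Qed.

(** The factor [y] moves inside the power, so that [sum_min_powR_le] applies with [th] equal to [Q]
    times the [p]-th power of [y]. Since [1 <= B], scaling by [B] costs at most [B ^+ 2] in either
    branch of the minimum. *)
Lemma sum_min_le (F : nat -> R) (B y : R) (Q : nat) : 1 <= B -> 0 <= y ->
  (forall u, (u < Q)%N -> 0 <= F u <= B * (Q%:R / u.+1%:R) `^ p^-1) ->
  \sum_(u < Q) Num.min (y * F u) ((y * F u) ^+ 2) <=
  B ^+ 2 * upper_const * (y `^ p * Q%:R).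
Proof.
move=> B1 y0 hF.
have E (u : nat) : y * (Q%:R / u.+1%:R) `^ p^-1 =
    (y `^ p * Q%:R / u.+1%:R) `^ p^-1.
  rewrite -mulrA powRM ?powR_ge0 ?divr_ge0 // -powRrM mulfV ?gt_eqF //.
  by rewrite powRr1.
have := sum_min_powR_le Q pV (mulr_ge0 (powR_ge0 y p) (ler0n R Q)).
move/(ler_wpM2l (exprn_ge0 2 (le_trans ler01 B1))) => h.
rewrite -mulrA; apply: le_trans h; rewrite mulr_sumr.
apply: ler_sum => u _; rewrite -E; have /andP[F0 FB] := hF u (ltn_ord u).
move: FB; set v := _ `^ _ => FB; have v0 : 0 <= v by apply: powR_ge0.
have h1 : y * F u <= B * (y * v) by rewrite mulrCA ler_wpM2l.
have h2 : 0 <= y * F u by rewrite mulr_ge0.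
have h3 : 0 <= y * v by rewrite mulr_ge0.
move: h1 h2 h3; set s := y * F u; set t := y * v => h1 h2 h3.
rewrite minr_pMr ?exprn_ge0 ?(le_trans ler01) // le_min !ge_min.
apply/andP; split; apply/orP; [left|right].
  by apply: le_trans h1 _; rewrite ler_wpM2r // expr2 ler_peMl //; lra.
by rewrite -exprMn ler_sqr ?nnegrE // mulr_ge0 //; lra.
Qed.

Definition row_sum n (Q : nat) (F : nat -> R) (x : 'I_n -> R)
    (a b a' b' : nat) : R :=
  \sum_i (x i * F ((a + b * i) %% Q)%N) * hsign R Q ((a' + b' * i) %% Q).

(** Averaging over the signs first leaves truncated moments of single coordinates, so of the hash
    values only the uniformity of each one matters. *)
Lemma row_sum_le n D (F : nat -> R) (B : R) (x : 'I_n -> R) :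
  (n <= 2 ^ D)%N -> 1 <= B ->
  (forall u, (u < 2 ^ D.+1)%N ->
    0 <= F u <= B * ((2 ^ D.+1)%:R / u.+1%:R) `^ p^-1) ->
  \sum_i `|x i| `^ p = 1 ->
  \sum_(a < 2 ^ D.+1) \sum_(b < 2 ^ D.+1)
    \sum_(a' < 2 ^ D.+1) \sum_(b' < 2 ^ D.+1)
      `|row_sum (2 ^ D.+1) F x a b a' b'| <=
  (1 + B ^+ 2 * upper_const) * (2 ^ D.+1)%:R ^+ 4.
Proof.
move=> nD B1 hF x1; set Q := (2 ^ D.+1)%N in hF *.
pose m (i : 'I_n) u := Num.min (`|x i| * F u) ((`|x i| * F u) ^+ 2).
apply: (@le_trans _ _ (\sum_(a < Q) \sum_(b < Q)
    (1 + \sum_i m i ((a + b * i) %% Q)%N) * Q%:R ^+ 2)).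
  apply: ler_sum => a _; apply: ler_sum => b _.
  apply: le_trans (norm_sum_eps_le _ nD) _; rewrite -/Q ler_wpM2r ?exprn_ge0 //.
  rewrite lerD2l; apply: ler_sum => i _; rewrite /m normrM.
  have /andP[F0 _] : 0 <= F ((a + b * i) %% Q)%N <=
      B * (Q%:R / ((a + b * i) %% Q)%N.+1%:R) `^ p^-1.
    by apply: hF; rewrite ltn_mod expn_gt0.
  by rewrite (ger0_norm F0) !exprMn real_normK ?num_real.
have -> : \sum_(a < Q) \sum_(b < Q)
    (1 + \sum_i m i ((a + b * i) %% Q)%N) * Q%:R ^+ 2 =
    (Q%:R ^+ 2 + Q%:R * \sum_i \sum_(u < Q) m i u) * Q%:R ^+ 2.
  under eq_bigr do rewrite -mulr_suml.
  rewrite -mulr_suml; congr (_ * _).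
  under eq_bigr do rewrite big_split /=.
  rewrite big_split /= !sumr_const card_ord; congr (_ + _).
    by rewrite -mulrnA natrM.
  under eq_bigr do rewrite exchange_big /=.
  rewrite exchange_big /= mulr_sumr; apply: eq_bigr => i _.
  by rewrite (sum_affine (m i)) mulr_natl.
rewrite (_ : (1 + _) * _ = (Q%:R ^+ 2 + Q%:R *
   (B ^+ 2 * upper_const * Q%:R)) * Q%:R ^+ 2); last by ring.
rewrite ler_wpM2r ?exprn_ge0 // lerD2l ler_wpM2l //.
apply: (@le_trans _ _ (\sum_i B ^+ 2 * upper_const * (`|x i| `^ p * Q%:R))).
  by apply: ler_sum => i _; apply: sum_min_le.
by rewrite -mulr_sumr -mulr_suml x1 mul1r.
Qed.


(* The pointwise bound [1 >= 2/3 * Z - Z^2/9] for the number [Z] of hits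
   replaces the Paley-Zygmund inequality. *)
Lemma row_sum_ge n D c (F : nat -> R) (A : R) (x : 'I_n -> R) :
  (0 < n <= c)%N -> (c <= 2 ^ D)%N -> (4 * c * n <= 2 ^ D.+1)%N -> 0 < A ->
  (forall u, (u < 2 ^ D.+1)%N ->
    A * ((2 ^ D.+1)%:R / (u + c)%:R) `^ p^-1 <= F u) ->
  \sum_i `|x i| `^ p = 1 ->
  A / 24 * (2 ^ D.+1)%:R ^+ 4 <=
  \sum_(a < 2 ^ D.+1) \sum_(b < 2 ^ D.+1)
    \sum_(a' < 2 ^ D.+1) \sum_(b' < 2 ^ D.+1)
      `|row_sum (2 ^ D.+1) F x a b a' b'|.
Proof.
move=> /andP[n0 nc] cD; set Q := (2 ^ D.+1)%N => cQ A0 hF x1.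
have Q0 : 0 < Q%:R :> R by rewrite ltr0n expn_gt0.
have n0R : 0 < n%:R :> R by rewrite ltr0n.
have c1R : 1 <= c%:R :> R by rewrite ler1n (leq_trans n0 nc).
pose w i := `|x i| `^ p; have w0 i : 0 <= w i by apply: powR_ge0.
(* Coordinates of weight below [(2 * n)^-1] are discarded; together they carry at most half of the
   total weight 1. For the others [4 * c * n <= Q] makes the threshold at least [c], as [count_pair]
   requires. *)
pose th (i : 'I_n) : nat :=
  if (2 * n%:R)^-1 <= w i then Num.truncn (Q%:R * w i) else 0%N.
have Qw i : (2 * n%:R)^-1 <= w i -> 2 * c%:R <= Q%:R * w i.
  move=> wi; apply: le_trans (ler_wpM2l (ltW Q0) wi).
  rewrite ler_pdivlMr ?mulr_gt0 //.
  move: cQ; rewrite -(ler_nat R) !natrM; lra.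
have th_le i : (th i)%:R <= Q%:R * w i.
  by rewrite /th; case: ifP => _; rewrite ?truncn_le mulr_ge0 // ltW.
have th_ge i : (2 * n%:R)^-1 <= w i -> Q%:R * w i <= 2 * (th i)%:R.
  move=> wi; have := Qw i wi; rewrite /th wi.
  by have := truncnS_gt (Q%:R * w i); rewrite -natr1; lra.
have th_c i : th i = 0%N \/ (c <= th i)%N.
  have [wi|wi] := leP (2 * n%:R)^-1 (w i); last by left; rewrite /th leNgt wi.
  by right; rewrite -(ler_nat R); have := th_ge i wi; have := Qw i wi; lra.
pose hit (a b : nat) (i : 'I_n) := ((a + b * i) %% Q < th i)%N.
pose Z (a b : nat) : R := \sum_(i < n) (hit a b i)%:R.
pose T : R := \sum_i (th i)%:R.
have TQ : T <= Q%:R.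
  apply: (@le_trans _ _ (\sum_i Q%:R * w i)).
    by apply: ler_sum => i _; exact: th_le.
  by rewrite -mulr_sumr x1 mulr1.
(* Subtracting [(2 * n)^-1] from each of the [n] weights leaves a total of 1/2, and rounding down
   the thresholds loses at most another factor 2. *)
have QT : Q%:R / 4 <= T.
  have -> : Q%:R / 4 = \sum_(i < n) Q%:R * (w i - (2 * n%:R)^-1) / 2.
    rewrite -mulr_suml -mulr_sumr sumrB x1 sumr_const card_ord -[_ *+ n]mulr_natr.
    by field; rewrite gt_eqF.
  apply: ler_sum => i _; have [wi|wi] := leP (2 * n%:R)^-1 (w i).
    have h1 := th_ge i wi; have h2 : 0 <= Q%:R * (2 * n%:R)^-1 :> R.
      by rewrite mulr_ge0 // invr_ge0 mulr_ge0.
    by rewrite mulrBr; lra.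
  apply: le_trans (ler0n _ _); rewrite pmulr_lle0 ?invr_gt0 // pmulr_rle0 //.
  lra.
have sumZ : \sum_(a < Q) \sum_(b < Q) Z a b = Q%:R * T.
  rewrite /Z; under eq_bigr do rewrite exchange_big /=.
  rewrite exchange_big /= mulr_sumr; apply: eq_bigr => i _.
  rewrite (sum_affine (fun u => (u < th i)%N%:R : R)) -[LHS]mulr_natl.
  congr (_ * _); rewrite -natr_sum; congr _%:R; apply: sum_ltn.
  by rewrite -(ler_nat R); apply: le_trans (th_le i) _;
    rewrite ler_piMr ?(ltW Q0) // -x1 (bigD1 i) //= lerDl sumr_ge0.
(* The diagonal contributes [Q * T] by [count_single], the remaining pairs at most [2 * T ^+ 2] by
   [count_pair]. *)
have sumZ2 : \sum_(a < Q) \sum_(b < Q) Z a b ^+ 2 <= Q%:R * T + 2 * T ^+ 2.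
  have -> : \sum_(a < Q) \sum_(b < Q) Z a b ^+ 2 = \sum_i \sum_j
      (\sum_(a < Q) \sum_(b < Q) (hit a b i && hit a b j))%N%:R.
    under eq_bigr => a _.
      under eq_bigr => b _.
        rewrite expr2 mulr_suml; under eq_bigr do rewrite mulr_sumr.
        over.
      rewrite exchange_big /=; under eq_bigr do rewrite exchange_big /=.
      over.
    rewrite exchange_big /=; apply: eq_bigr => i _; rewrite exchange_big /=.
    apply: eq_bigr => j _; rewrite natr_sum; apply: eq_bigr => a _.
    by rewrite natr_sum; apply: eq_bigr => b _; rewrite -natrM mulnb.
  have -> : Q%:R * T + 2 * T ^+ 2 = \sum_i \sum_j
     ((i == j)%:R * (Q%:R * (th i)%:R) + 2 * (th i)%:R * (th j)%:R).
    transitivity (\sum_i (Q%:R * (th i)%:R + 2 * (th i)%:R * T)).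
      rewrite big_split /= -mulr_sumr -mulr_suml -mulr_sumr -/T; ring.
    apply: eq_bigr => i _; rewrite big_split /= -mulr_sumr -/T; congr (_ + _).
    rewrite (bigD1 i) //= eqxx mul1r big1 ?addr0 // => j /negbTE.
    by rewrite eq_sym => ->; rewrite mul0r.
  apply: ler_sum => i _; apply: ler_sum => j _; have [->|ij] := eqVneq i j.
    rewrite mul1r; apply: (@le_trans _ _ (Q%:R * (th j)%:R)); last first.
      by rewrite lerDl !mulr_ge0.
    rewrite -natrM ler_nat; apply: leq_trans (count_single Q j (th j)).
    apply: leq_sum => a _; apply: leq_sum => b _; by rewrite andbb.
  rewrite mul0r add0r -!natrM ler_nat; apply: count_pair (th_c i) (th_c j).
  - by apply: contraNneq ij => /val_inj ->.
  - exact: leq_trans (ltn_ord i) nc.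
  - exact: leq_trans (ltn_ord j) nc.
(* Without a hit the left-hand side is 0. Otherwise a single hit coordinate, of size at least
   [A / 2], bounds the sum over the signs through [le_norm_sum_eps]. *)
have pt (a b : 'I_Q) : A / 2 * (2 / 3 * Z a b - Z a b ^+ 2 / 9) * Q%:R ^+ 2 <=
    \sum_(a' < Q) \sum_(b' < Q) `|row_sum Q F x a b a' b'|.
  have [i hi|h0] := pickP (hit a b); last first.
    rewrite /Z big1 => [|i _]; last by rewrite h0.
    rewrite expr0n mulr0 mul0r subrr mulr0 mul0r.
    by apply: sumr_ge0 => a' _; apply: sumr_ge0.
  have := @le_norm_sum_eps _ n D
    (fun i => x i * F ((a + b * i) %% Q)%N) (leq_trans nc cD) i.
  apply: le_trans; rewrite ler_wpM2r ?exprn_ge0 //.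
  have wi : (2 * n%:R)^-1 <= w i by move: hi; rewrite /hit /th; case: ifP.
  move: hi; rewrite /hit; set u := (_ %% _)%N => hi.
  have uc : (u + c)%:R <= 2 * (Q%:R * w i).
    have : (u <= th i)%N by exact: ltnW.
    rewrite natrD -(ler_nat R).
    by have := th_le i; have := Qw i wi; lra.
  have wp : 0 < w i by apply: lt_le_trans wi; rewrite invr_gt0 mulr_gt0.
  have uc0 : 0 < (u + c)%:R :> R by rewrite ltr0n addn_gt0 (leq_trans n0 nc) orbT.
  have xw : `|x i| = w i `^ p^-1.
    by rewrite /w -powRrM mulfV ?gt_eqF // powRr1.
  (* By [uc] the ratio [w i * Q / (u + c)] is at least 1/2, and so is its power with exponent
     [p^-1 <= 1]. *)
  have low : A / 2 <= `|x i| * F u.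
    apply: (@le_trans _ _ (`|x i| * (A * (Q%:R / (u + c)%:R) `^ p^-1))); last first.
      by rewrite ler_wpM2l // hF // /u ltn_mod expn_gt0.
    rewrite mulrCA ler_wpM2l ?(ltW A0) // xw -powRM ?divr_ge0 ?(ltW wp) //.
    apply: (@le_trans _ _ (2^-1 `^ p^-1)).
      by rewrite ger1_powR // ?invf_le1 ?(ltW hp1) //; apply/andP; split; lra.
    rewrite ge0_ler_powR ?nnegrE ?invr_ge0 ?mulr_ge0 ?(ltW p0) ?(ltW wp) //.
    rewrite mulrA ler_pdivlMr //; lra.
  apply: (@le_trans _ _ (A / 2)); last by rewrite normrM; apply: le_trans low _;
    rewrite ler_wpM2l // ler_norm.
  rewrite -[leRHS]mulr1 ler_wpM2l ?divr_ge0 ?(ltW A0) //.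
  have := sqr_ge0 (Z a b / 3 - 1); lra.
apply: (@le_trans _ _ (\sum_(a < Q) \sum_(b < Q)
  A / 2 * (2 / 3 * Z a b - Z a b ^+ 2 / 9) * Q%:R ^+ 2)); last first.
  by apply: ler_sum => a _; apply: ler_sum => b _; exact: pt.
have -> : \sum_(a < Q) \sum_(b < Q)
    A / 2 * (2 / 3 * Z a b - Z a b ^+ 2 / 9) * Q%:R ^+ 2 =
  A / 2 * (2 / 3 * (\sum_(a < Q) \sum_(b < Q) Z a b) -
    (\sum_(a < Q) \sum_(b < Q) Z a b ^+ 2) / 9) * Q%:R ^+ 2.
  under eq_bigr do rewrite -mulr_suml -mulr_sumr sumrB -mulr_sumr -mulr_suml.
  by rewrite -mulr_suml -mulr_sumr sumrB -mulr_sumr -mulr_suml.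
rewrite sumZ (_ : A / 24 * _ = A / 2 * (Q%:R ^+ 2 / 12) * Q%:R ^+ 2);
  last by field.
rewrite ler_wpM2r ?exprn_ge0 // ler_wpM2l ?divr_ge0 ?(ltW A0) //.
move: sumZ2; set z := \sum_(a < Q) _ => z2.
(* The middle term is at least [Q * T / 3] because [T <= Q], hence at least [Q ^+ 2 / 12] because
   [Q / 4 <= T]. *)
apply: (@le_trans _ _ (2 / 3 * (Q%:R * T) - (Q%:R * T + 2 * T ^+ 2) / 9)); last lra.
nra.
Qed.

End Bounds.

(** * The matrix *)

(** For positive [Q] and [w], the base-2 logarithm of [Q / w], rounded up and never negative. It is
    also the number of iterations of the loop that computes the scale. *)
Definition doublings (Q w : nat) : nat :=
  find (fun t => Q <= 2 ^ t * w)%N (iota 0 Q).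

Lemma doublings_leq Q w : (doublings Q w <= Q)%N.
Proof. by rewrite -[leqRHS](size_iota 0) find_size. Qed.

Lemma doublings_ge Q w : (0 < w)%N -> (Q <= 2 ^ doublings Q w * w)%N.
Proof.
move=> w0; set t := doublings Q w.
have := doublings_leq Q w; rewrite -/t leq_eqVlt => /orP[/eqP->|tQ].
  by apply: leq_trans (leq_pmulr _ w0); apply/ltnW/ltn_expl.
have h : has (fun t => Q <= 2 ^ t * w)%N (iota 0 Q) by rewrite has_find size_iota.
by have := nth_find 0%N h; rewrite nth_iota // add0n.
Qed.

Lemma ltn_doublings Q w t : (t < doublings Q w)%N -> (2 ^ t * w < Q)%N.
Proof.
move=> ht; have tQ : (t < Q)%N := leq_trans ht (doublings_leq Q w).
by have := before_find 0%N ht; rewrite nth_iota // add0n ltnNge => ->.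
Qed.

(** At [w = u + c] this is the function [F], with [P / Q] in place of [p]. *)
Definition scale (Q P w : nat) : nat := (2 ^ (doublings Q w * Q %/ P))%N.

Section Sketch.
Variables (R : realType) (p : R).
Hypotheses (hp1 : 1 < p) (hp2 : p < 2).

Let p0 : 0 < p. Proof. exact: lt_trans hp1. Qed.

(* With [P / Q] within [1 / Q] of [p] and at most [Q] doublings, the exponent
   of [scale] is off by at most [1] from the number of doublings over [p]. *)
Lemma scale_bounds Q w : (0 < Q)%N -> (0 < w)%N -> (w <= 2 * Q)%N ->
  2^-1 * (Q%:R / w%:R) `^ p^-1 <= (scale Q (Num.truncn (p * Q%:R)) w)%:R /\
  (scale Q (Num.truncn (p * Q%:R)) w)%:R <= 4 * (Q%:R / w%:R) `^ p^-1.
Proof.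
move=> Q0 w0 wQ; rewrite /scale.
have Q0R : 0 < Q%:R :> R by rewrite ltr0n.
have w0R : 0 < w%:R :> R by rewrite ltr0n.
have pQ0 : 0 <= p * Q%:R by rewrite mulr_ge0 ?ltW.
set P := Num.truncn (p * Q%:R).
have P1 : P%:R <= p * Q%:R by rewrite truncn_le.
have P2 : p * Q%:R < P%:R + 1 by rewrite natr1 truncnS_gt.
have QP : (Q <= P)%N by rewrite truncn_ge_nat // ler_peMl ?ltW.
have P0 : (0 < P)%N := leq_trans Q0 QP.
have tQ := doublings_leq Q w; have := @doublings_ge Q w w0.
have := @ltn_doublings Q w; move: tQ; set t := doublings Q w => tQ tlt tge.
set k := (t * Q %/ P)%N; rewrite natrX.
have k1 : (k * P <= t * Q)%N by exact: leq_trunc_div.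
have k2 : (t * Q < k.+1 * P)%N by exact: ltn_ceil.
have kt : (k <= t)%N.
  rewrite -(leq_pmul2r P0); apply: leq_trans k1 _; by rewrite leq_mul2l QP orbT.
set rho := Q%:R / w%:R; have rho0 : 0 < rho by rewrite divr_gt0.
have rho1 : rho <= 2 ^+ t.
  by rewrite ler_pdivrMr // -natrX -natrM ler_nat.
have rho2 : 2 ^+ t <= 2 * rho.
  rewrite mulrA ler_pdivlMr // -natrX -!natrM ler_nat.
  (* With no doubling the claim is [w <= 2 * Q]; otherwise one doubling fewer falls short of [Q]. *)
  case: (t) tlt => [|s] h; first by rewrite mul1n.
  by rewrite expnS -mulnA leq_mul2l ltnW ?orbT // h.
have pow (s : nat) : (2 ^+ s) `^ p^-1 = 2 `^ (s%:R / p) :> R.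
  by rewrite -powR_mulrn // -powRrM.
split.
  rewrite mulrC ler_pdivrMr // -exprSr.
  apply: (@le_trans _ _ ((2 ^+ t) `^ p^-1)).
    by rewrite ge0_ler_powR ?nnegrE ?exprn_ge0 ?invr_ge0 ?(ltW p0) ?(ltW rho0).
  rewrite pow -powR_mulrn // ler_powR ?ler1n // ler_pdivrMr //.
  rewrite -(ler_pM2r Q0R) -mulrA; apply: (@le_trans _ _ (k.+1%:R * P%:R)).
    by rewrite -!natrM ler_nat ltnW.
  by rewrite ler_wpM2l.
(* Replacing [P] by [P + 1] costs [k <= t <= Q], which is at most one more multiple of [Q]. *)
have k3 : k%:R * p <= t.+1%:R.
  rewrite -(ler_pM2r Q0R) -mulrA.
  apply: (@le_trans _ _ (k%:R * (P%:R + 1))); first by rewrite ler_wpM2l // ltW.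
  rewrite mulrDr mulr1 -!natrM -natrD ler_nat mulSn addnC.
  by apply: leq_add => //; exact: leq_trans kt tQ.
apply: (@le_trans _ _ ((2 ^+ t.+1) `^ p^-1)).
  by rewrite pow -powR_mulrn // ler_powR ?ler1n // ler_pdivlMr.
apply: (@le_trans _ _ ((4 * rho) `^ p^-1)).
  rewrite ge0_ler_powR ?nnegrE ?exprn_ge0 ?invr_ge0 ?(ltW p0) ?mulr_ge0 ?(ltW rho0) //.
  rewrite exprS; lra.
rewrite powRM ?(ltW rho0) // ler_wpM2r ?powR_ge0 //.
by rewrite ler1_powR ?invf_le1 ?(ltW hp1) // ler1n.
Qed.

(** The four base-[Q] digits of a row index serve as the hash coefficients [a], [b], [a'], [b']. *)
Lemma sum_digits (V : nmodType) (f : nat -> nat -> nat -> nat -> V) (Q : nat) :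
  \sum_(r < Q * Q * Q * Q)
    f (r %/ Q %/ Q %/ Q %% Q)%N (r %/ Q %/ Q %% Q)%N (r %/ Q %% Q)%N (r %% Q)%N =
  \sum_(a < Q) \sum_(b < Q) \sum_(a' < Q) \sum_(b' < Q) f a b a' b'.
Proof.
have dE (q : nat) (e : 'I_Q) : ((q * Q + e) %/ Q = q)%N.
  by rewrite divnMDl ?divn_small ?addn0 //; case: Q e => // -[].
have mE (q : nat) (e : 'I_Q) : ((q * Q + e) %% Q = e)%N.
  by rewrite modnMDl modn_small.
rewrite (sum_blocks (fun r => f (r %/ Q %/ Q %/ Q %% Q)%N
  (r %/ Q %/ Q %% Q)%N (r %/ Q %% Q)%N (r %% Q)%N)) /=.
under eq_bigr do under eq_bigr do rewrite dE mE.
rewrite (sum_blocks (fun r => \sum_(e < Q) f (r %/ Q %/ Q %% Q)%N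
  (r %/ Q %% Q)%N (r %% Q)%N e)) /=.
under eq_bigr do under eq_bigr do under eq_bigr do rewrite dE mE.
rewrite (sum_blocks (fun r => \sum_(d < Q) \sum_(e < Q) f (r %/ Q %% Q)%N
  (r %% Q)%N d e)) /=.
apply: eq_bigr => a _; apply: eq_bigr => b _; apply: eq_bigr => a' _.
by apply: eq_bigr => b' _; rewrite dE mE modn_small.
Qed.

Variables (n e : nat).
Let c := (2 ^ e)%N.
Let Q := (4 * (c * c))%N.

(** [Q] is a power of two, for the orthogonality of the signs, and at least [4 * c * n] once
    [n <= c], for the lower bound. The division by the number of rows turns the sum over the rows
    into a mean. *)
Definition sketch : 'M[R]_(Q * Q * Q * Q, n) :=
  \matrix_(r, j)
    (hsign R Q ((r %/ Q %% Q + r %% Q * j) %% Q) *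
     (scale Q (Num.truncn (p * Q%:R))
       ((r %/ Q %/ Q %/ Q %% Q + r %/ Q %/ Q %% Q * j) %% Q + c))%:R
     / (Q * Q * Q * Q)%:R).

Lemma lpnorm1E m (y : 'cV[R]_m) : lpnorm 1 y = \sum_i `|y i 0|.
Proof.
rewrite /lpnorm invr1 powRr1; last by apply: sumr_ge0 => i _; exact: powR_ge0.
by apply: eq_bigr => i _; rewrite powRr1.
Qed.

Lemma lpnorm_ge0 m q (y : 'cV[R]_m) : 0 <= lpnorm q y.
Proof. exact: powR_ge0. Qed.

(** By homogeneity [x] may be divided by its norm. The factors of [scale_bounds] enter as
    [A = 2^-1], whence [A / 24 = 48^-1], and as [B = 4]. *)
Lemma lpnorm_sketch (x : 'cV[R]_n) : (n <= c)%N ->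
  48^-1 * lpnorm p x <= lpnorm 1 (sketch *m x) /\
  lpnorm 1 (sketch *m x) <= (1 + 4 ^+ 2 * upper_const p) * lpnorm p x.
Proof.
move=> nc; have c0 : (0 < c)%N by rewrite expn_gt0.
have QE : Q = (2 ^ (e + e).+1.+1)%N by rewrite !expnS expnD (mulnA 2).
have Q0 : (0 < Q)%N by rewrite QE expn_gt0.
have Q0R : 0 < Q%:R :> R by rewrite ltr0n.
have cD : (c <= 2 ^ (e + e).+1)%N by rewrite leq_exp2l // leqW // leq_addr.
pose F u : R := (scale Q (Num.truncn (p * Q%:R)) (u + c))%:R.
have FB u : (u < Q)%N ->
    2^-1 * (Q%:R / (u + c)%:R) `^ p^-1 <= F u <= 4 * (Q%:R / u.+1%:R) `^ p^-1.
  move=> uQ; have uc0 : (0 < u + c)%N by rewrite addn_gt0 c0 orbT.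
  have ucQ : (u + c <= 2 * Q)%N.
    rewrite mul2n -addnn leq_add ?(ltnW uQ) // /Q mulnA leq_pmull //.
    by rewrite muln_gt0.
  have [-> h] := scale_bounds Q0 uc0 ucQ; apply: le_trans h _.
  rewrite ler_wpM2l // ge0_ler_powR ?nnegrE ?divr_ge0 ?invr_ge0 ?(ltW p0) //.
  rewrite ler_wpM2l // lef_pV2 ?posrE ?ltr0n // ler_nat.
  by rewrite -addn1 leq_add2l.
pose l := lpnorm p x.
have lpE : l `^ p = \sum_i `|x i 0| `^ p.
  rewrite /l /lpnorm -powRrM mulVf ?gt_eqF // powRr1 //.
  by apply: sumr_ge0 => i _; exact: powR_ge0.
have l0 : 0 <= l by exact: lpnorm_ge0.
have Q4E : (Q * Q * Q * Q)%:R = Q%:R ^+ 4 :> R.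
  by rewrite -natrX !expnS expn0 muln1 !mulnA.
have normE : lpnorm 1 (sketch *m x) =
    (\sum_(a < Q) \sum_(b < Q) \sum_(a' < Q) \sum_(b' < Q)
      `|row_sum Q F (fun i => x i 0) a b a' b'|) / Q%:R ^+ 4.
  rewrite lpnorm1E -(sum_digits (fun a b a' b' =>
    `|row_sum Q F (fun i => x i 0) a b a' b'|)) mulr_suml; apply: eq_bigr => r _.
  rewrite mxE -[X in _ = _ * X]ger0_norm ?invr_ge0 ?exprn_ge0 // -normrM.
  congr `|_|; rewrite mulr_suml; apply: eq_bigr => j _; rewrite mxE Q4E.
  by rewrite -/(F _) mulrAC; congr (_ / _); rewrite mulrC mulrA mulrAC.
have [l1|l1] := eqVneq l 0.
  have x0 i : x i 0 = 0.
    have : \sum_i `|x i 0| `^ p = 0 by rewrite -lpE l1 powR0 // gt_eqF.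
    move/eqP; rewrite psumr_eq0 => [|j _].
      move/allP => /(_ i (mem_index_enum _)) /= /eqP h.
      by have /normr0_eq0 := powR_eq0_eq0 h.
    exact: powR_ge0.
  rewrite -/l l1 !mulr0 normE big1 ?mul0r // => a _; rewrite big1 // => b _.
  rewrite big1 // => a' _; rewrite big1 // => b' _.
  by rewrite /row_sum big1 ?normr0 // => i _; rewrite x0 !mul0r.
have lp : 0 < l by rewrite lt_neqAle eq_sym l1.
have n0 : (0 < n)%N.
  rewrite lt0n; apply: contra_neq l1 => nz; apply: (@powR_eq0_eq0 _ l p).
  by rewrite lpE big1 // => -[i ilt] _; exfalso; move: ilt; rewrite nz.
pose y i := x i 0 / l.
have y1 : \sum_i `|y i| `^ p = 1.
  under eq_bigr => i _ do rewrite /y normrM normfV (ger0_norm l0)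
    powRM ?invr_ge0 //.
  rewrite -mulr_suml -lpE -powRM ?invr_ge0 // mulfV // powR1 //.
have rE a b a' b' : `|row_sum Q F (fun i => x i 0) a b a' b'| =
    l * `|row_sum Q F y a b a' b'|.
  rewrite -{1}(ger0_norm l0) -normrM mulr_sumr; congr `|_|.
  apply: eq_bigr => i _; rewrite /y !mulrA; congr (_ * _ * _).
  by rewrite (mulrC l) mulfK.
have sE : \sum_(a < Q) \sum_(b < Q) \sum_(a' < Q) \sum_(b' < Q)
      `|row_sum Q F (fun i => x i 0) a b a' b'| = l *
    \sum_(a < Q) \sum_(b < Q) \sum_(a' < Q) \sum_(b' < Q)
      `|row_sum Q F y a b a' b'|.
  rewrite mulr_sumr; apply: eq_bigr => a _.
  rewrite mulr_sumr; apply: eq_bigr => b _.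
  rewrite mulr_sumr; apply: eq_bigr => a' _.
  by rewrite mulr_sumr; apply: eq_bigr => b' _; rewrite rE.
have Q4 : 0 < Q%:R ^+ 4 :> R by rewrite exprn_gt0.
have cQ : (4 * c * n <= Q)%N by rewrite /Q mulnA leq_mul2l nc orbT.
rewrite normE sE -/l; split.
  have := @row_sum_ge _ _ hp1 n (e + e).+1 c F 2^-1 y.
  rewrite -QE n0 nc invr_gt0 ltr0n => /(_ isT cD cQ isT) h.
  rewrite ler_pdivlMr // mulrAC [leRHS]mulrC ler_wpM2r //.
  apply: le_trans (h _ y1); first by rewrite ler_wpM2r ?(ltW Q4) //; lra.
  by move=> u /FB/andP[].
have := @row_sum_le _ _ hp1 hp2 n (e + e).+1 F 4 y (leq_trans nc cD).
rewrite -QE ler1n => /(_ isT) h.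
rewrite ler_pdivrMr // mulrAC mulrC ler_wpM2r //; apply: h => // u /FB/andP[_ ->].
by rewrite ler0n.
Qed.

End Sketch.

(** * The program *)

Local Open Scope nat_scope.

Definition block (cs : seq (nat * expr)) (c : com) : com :=
  foldr (fun ie => Seq (Assign ie.1 ie.2)) c cs.

Definition block_cost (cs : seq (nat * expr)) : nat :=
  sumn [seq (esize ie.2).+1 | ie <- cs].

Definition block_regs dig (m : nat -> nat) :=
  foldl (fun l (ie : nat * expr) => set_nth 0 l ie.1 (eval dig (St l m) ie.2)).

Lemma runs_block dig cs c l m N s' : all (fun ie => mulfree ie.2) cs ->
  runs dig c (St (block_regs dig m l cs) m) N s' ->
  runs dig (block cs c) (St l m) (block_cost cs + N) s'.
Proof.
elim: cs l => [|ie cs IH] l //= /andP[h hs] H; rewrite /block_cost /= -addnA.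
apply: runs_seq; first exact: runs_assign.
by rewrite set_regE; apply: IH.
Qed.

Lemma runs_skip dig s : runs dig Skip s 1 s.
Proof.
move=> B hB; split; first by apply: bounded_leq hB; rewrite leq_addr.
by exists 1; [exact: exec_skip|rewrite mul1n addn1].
Qed.

Lemma runs_block_skip dig cs l l' m : all (fun ie => mulfree ie.2) cs ->
  block_regs dig m l cs = l' ->
  runs dig (block cs Skip) (St l m) (block_cost cs + 1) (St l' m).
Proof. by move=> h <-; apply: runs_block h _; exact: runs_skip. Qed.

Lemma runs_writeS dig a e v k c l m N s' : mulfree a -> mulfree e ->
  eval dig (St l m) a = k -> eval dig (St l m) e = v ->
  runs dig c (St l [eta m with k |-> v]) N s' ->
  runs dig (Seq (Write a e) c) (St l m) ((esize a + esize e).+1 + N) s'.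
Proof. by move=> ha he <- <-; apply: runs_seq; exact: runs_write. Qed.

Definition ltR i j := Op Lt (Reg i) (Reg j).
Definition addR i j := Op Add (Reg i) (Reg j).
Definition incR i k := Op Add (Reg i) (Const k).
Definition divR e i := Op Div e (Reg i).
Definition modR e i := Op Mod e (Reg i).

(* Registers: 0 n, 1 c, 2 Q, 3 P, 4 and 5 counters of the second loop,
   6 the number of rows, 7 the row r, 8 the next address, 9 the column j,
   10 to 13 the hash values and their increments, 14 the scale, 15 and 16
   the state of its computation.  Dividing by a comparison, which is 1 or by
   convention 0, keeps or annihilates the dividend. *)
Definition scale_step : seq (nat * expr) :=
  [:: (16, addR 16 16); (15, addR 15 2);
  (14, Op Add (Reg 14) (Op Div (Reg 14) (Op Lt (Reg 3) (incR 15 1))));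
  (15, modR (Reg 15) 3)].
Definition dim_step : seq (nat * expr) :=
  [:: (1, addR 1 1);
  (2, Op Add (addR 2 2) (addR 2 2))].
Definition digit_step : seq (nat * expr) :=
  [:: (4, addR 4 4); (5, incR 5 1);
  (3, Op Add (addR 3 3) (Digit (Reg 5)));
  (6, addR 6 6); (6, addR 6 6); (6, addR 6 6); (6, addR 6 6)].
Definition col_init : seq (nat * expr) :=
  [:: (14, Const 1); (15, Const 0); (16, addR 10 1)].
(** Clearing the scratch registers 14 to 16 gives the states between iterations one closed form. *)
Definition col_next : seq (nat * expr) :=
  [:: (8, incR 8 3); (10, modR (addR 10 11) 2);
  (12, modR (addR 12 13) 2); (9, incR 9 1);
  (14, Const 0); (15, Const 0); (16, Const 0)].
Definition row_init : seq (nat * expr) :=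
  [:: (10, modR (divR (divR (divR (Reg 7) 2) 2) 2) 2);
  (11, modR (divR (divR (Reg 7) 2) 2) 2);
  (12, modR (divR (Reg 7) 2) 2); (13, modR (Reg 7) 2)].
Definition row_next : seq (nat * expr) :=
  [:: (7, incR 7 1); (9, Const 0); (10, Const 0); (11, Const 0);
  (12, Const 0); (13, Const 0)].

Definition dim_body := block dim_step Skip.

Definition digit_body := block digit_step Skip.

Definition scale_body := block scale_step Skip.

Definition positive := Op Lt (addR 12 12) (Reg 2).

Definition col_body :=
  block col_init
  (Seq (While (ltR 16 2) scale_body)
  (Seq (Write (Reg 8) (Op Div (Reg 14) positive))
  (Seq (Write (incR 8 1) (Op Div (Reg 14) (Op Eq positive (Const 0))))
  (Seq (Write (incR 8 2) (Reg 6))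
  (block col_next Skip))))).

Definition row_body :=
  block row_init
  (Seq (While (ltR 9 0) col_body)
  (block row_next Skip)).

(** The first loop finds [c] and [Q]; the second reads [P] off the digits of [p] and computes the
    number of rows; the third writes the rows. Register 3 starts at 1, the integer part of [p].
    Repeated addition replaces all products. *)
Definition program :=
  block [:: (1, Const 1); (2, Const 4)]
  (Seq (While (ltR 1 0) dim_body)
  (block [:: (3, Const 1); (4, Const 1); (6, Const 1)]
  (Seq (While (ltR 4 2) digit_body)
  (Seq (While (ltR 7 6) row_body)
  (block [:: (0, Reg 6)] Skip))))).

(** * Correctness of the program, loop by loop *)

Section Program.
Variables (dig : nat -> bool) (n c Q P M : nat).
Hypotheses (c0 : 0 < c) (Q0 : 0 < Q) (QP : Q <= P).

Let P0 : 0 < P. Proof. exact: leq_trans QP. Qed.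

(** As [Q <= P], adding [Q] to the remainder wraps around at most once. The exponent of the scale
    therefore grows by 0 or 1 per step, and the program needs only the remainder. *)
Lemma divn_step t : t.+1 * Q %/ P = t * Q %/ P + (P <= (t * Q) %% P + Q).
Proof.
rewrite mulSn addnC {1}(divn_eq (t * Q) P) -addnA divnMDl //; congr (_ + _).
have lt1 : (t * Q) %% P < P by rewrite ltn_mod.
case: leqP => h; last by rewrite divn_small.
rewrite -(subnK h) addnC -{1}(mul1n P) divnMDl // divn_small ?addn0 //.
by rewrite ltn_subLR //; apply: leq_trans (_ : P + Q <= _);
  rewrite ?leq_add2l // ltn_add2r.
Qed.

Definition scale_cost : nat := Q.+1 * (3 + (block_cost scale_step + 1)).+1.

Lemma runs_scale r4 r5 r7 r8 r9 u r11 r12 r13 m :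
  let w := u + c in let T := doublings Q w in
  runs dig (While (ltR 16 2) scale_body)
   (St [:: n; c; Q; P; r4; r5; M; r7; r8; r9; u; r11; r12; r13; 1; 0; w] m)
   scale_cost
   (St [:: n; c; Q; P; r4; r5; M; r7; r8; r9; u; r11; r12; r13;
     scale Q P w; (T * Q) %% P; 2 ^ T * w] m).
Proof.
move=> w T; have w0 : 0 < w by rewrite /w addn_gt0 c0 orbT.
pose f t := St [:: n; c; Q; P; r4; r5; M; r7; r8; r9; u; r11; r12; r13;
     2 ^ (t * Q %/ P); (t * Q) %% P; 2 ^ t * w] m.
have -> : St [:: n; c; Q; P; r4; r5; M; r7; r8; r9; u; r11; r12; r13; 1; 0; w] m
    = f 0 by rewrite /f mul0n div0n mod0n expn0 mul1n.
apply: (@runs_leq _ _ _ (T.+1 * (3 + (block_cost scale_step + 1)).+1)).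
  by rewrite leq_mul2r ltnS doublings_leq orbT.
apply: (runs_while (f := f)) => //= [t tT|t tT|].
- by rewrite ltn_doublings.
- apply: (@runs_block_skip _ scale_step) => //=; rewrite /block_regs /=.
  have -> : 2 ^ t * w + 2 ^ t * w = 2 ^ t.+1 * w by rewrite expnS -mulnA mul2n addnn.
  have -> : ((t * Q) %% P + Q) %% P = (t.+1 * Q) %% P by rewrite modnDml mulSnr.
  (* The added 1 turns the strict comparison of the machine into the [<=] of [divn_step]. *)
  suff -> : 2 ^ (t * Q %/ P) + 2 ^ (t * Q %/ P) %/ (P < (t * Q) %% P + Q + 1) =
    2 ^ (t.+1 * Q %/ P) by [].
  rewrite divn_step addn1 ltnS; case: (P <= _).
    by rewrite divn1 addn1 expnS mul2n addnn.
  by rewrite divn0 !addn0.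
- by rewrite ltnNge doublings_ge.
Qed.

(** Memory is an initial segment of one fixed table, so that writing the next cell only changes the
    length [L]. *)
Definition filled (V : nat -> nat) (L a : nat) : nat := if a < L then V a else 0.

Lemma filledS (V : nat -> nat) L :
  [eta filled V L with L |-> V L] = filled V L.+1 :> (nat -> nat).
Proof.
apply/funext => a; rewrite /filled /= (ltnS a) (leq_eqVlt a).
by case: eqVneq => [->|].
Qed.

Definition hash1 r j := (r %/ Q %/ Q %/ Q %% Q + r %/ Q %/ Q %% Q * j) %% Q.
Definition hash2 r j := (r %/ Q %% Q + r %% Q * j) %% Q.

Definition cell (a : nat) : nat :=
  let r := a %/ 3 %/ n in let j := (a %/ 3) %% n in
  let F := scale Q P (hash1 r j + c) in
  let s : bool := hash2 r j + hash2 r j < Q in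
  if a %% 3 == 0 then F %/ s else if a %% 3 == 1 then F %/ (~~ s) else M.

Definition entry_addr r j := 3 * (r * n + j).

Lemma cell_entry r j k : j < n -> k < 3 ->
  cell (entry_addr r j + k) =
  let F := scale Q P (hash1 r j + c) in
  let s : bool := hash2 r j + hash2 r j < Q in
  if k == 0 then F %/ s else if k == 1 then F %/ (~~ s) else M.
Proof.
move=> jn k3; have n0 : 0 < n by exact: leq_ltn_trans jn.
rewrite /cell /entry_addr mulnC divnMDl // (divn_small k3) addn0.
by rewrite !modnMDl (modn_small k3) divnMDl // (divn_small jn) addn0 modn_small.
Qed.

Definition col_cost : nat :=
  block_cost col_init +
  (scale_cost +
  ((esize (Reg 8) + esize (Op Div (Reg 14) positive)).+1 +
  ((esize (incR 8 1) + esize (Op Div (Reg 14) (Op Eq positive (Const 0)))).+1 +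
  ((esize (incR 8 2) + esize (Reg 6)).+1 +
  (block_cost col_next + 1))))).

Definition col_state r4 r5 r j :=
  St [:: n; c; Q; P; r4; r5; M; r; entry_addr r j; j;
    hash1 r j; r %/ Q %/ Q %% Q; hash2 r j; r %% Q; 0; 0; 0]
    (filled cell (entry_addr r j)).

Lemma runs_col r4 r5 r j : j < n ->
  runs dig col_body (col_state r4 r5 r j) col_cost (col_state r4 r5 r j.+1).
Proof.
move=> jn; apply: (@runs_block _ col_init) => //=; rewrite /block_regs /=.
apply: runs_seq; first exact: runs_scale.
apply: runs_writeS => //=; apply: runs_writeS => //=; apply: runs_writeS => //=.
have -> : ([eta [eta [eta filled cell (entry_addr r j) with
    entry_addr r j |-> scale Q P (hash1 r j + c) %/
      (hash2 r j + hash2 r j < Q)] with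
    entry_addr r j + 1 |-> scale Q P (hash1 r j + c) %/
      ((hash2 r j + hash2 r j < Q) == 0 :> nat)] with
    entry_addr r j + 2 |-> M] : nat -> nat) = filled cell (entry_addr r j.+1).
  have := cell_entry r jn (isT : 0 < 3); rewrite addn0 /= => <-.
  rewrite filledS.
  have -> : scale Q P (hash1 r j + c) %/
      ((hash2 r j + hash2 r j < Q) == 0 :> nat) = cell (entry_addr r j + 1).
    by rewrite cell_entry //=; case: (_ < Q).
  have -> : M = cell (entry_addr r j + 2) by rewrite cell_entry.
  by rewrite addn1 filledS addn2 filledS /entry_addr addnS mulnSr addn3.
apply: (@runs_block_skip _ col_next) => //; rewrite /block_regs /=.
(* One modular addition per column replaces the product with [j]. *)
have -> : (hash1 r j + r %/ Q %/ Q %% Q) %% Q = hash1 r j.+1.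
  by rewrite /hash1 modnDml -addnA -mulnSr.
have -> : (hash2 r j + r %% Q) %% Q = hash2 r j.+1.
  by rewrite /hash2 modnDml -addnA -mulnSr.
by rewrite addn1 /entry_addr (addnS _ j) mulnSr.
Qed.

Definition row_cost : nat :=
  block_cost row_init +
  (n.+1 * (3 + col_cost).+1 +
  (block_cost row_next + 1)).

Definition row_state r4 r5 r :=
  St [:: n; c; Q; P; r4; r5; M; r; 3 * (r * n); 0; 0; 0; 0; 0; 0; 0; 0]
    (filled cell (3 * (r * n))).

Lemma runs_row r4 r5 r :
  runs dig row_body (row_state r4 r5 r) row_cost (row_state r4 r5 r.+1).
Proof.
apply: (@runs_block _ row_init) => //=; rewrite /block_regs /=.
apply: (@runs_seq _ _ _ _ (col_state r4 r5 r n)); last first.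
  rewrite /col_state /entry_addr -mulSnr.
  by apply: (@runs_block_skip _ row_next) => //; rewrite /block_regs /= addn1.
set s0 := St _ _; have -> : s0 = col_state r4 r5 r 0.
  by rewrite /col_state /hash1 /hash2 !muln0 !addn0 !modn_mod /entry_addr addn0.
apply: runs_while => // [t tn|t tn|]; first by rewrite /= tn.
  exact: runs_col.
by rewrite /= ltnn.
Qed.

Definition program_cost (e s : nat) : nat :=
  block_cost [:: (1, Const 1); (2, Const 4)] +
  (e.+1 * (3 + (block_cost dim_step + 1)).+1 +
  (block_cost [:: (3, Const 1); (4, Const 1); (6, Const 1)] +
  (s.+1 * (3 + (block_cost digit_step + 1)).+1 +
  (M.+1 * (3 + row_cost).+1 + (block_cost [:: (0, Reg 6)] + 1))))).

End Program.

(** [prec t] stands for the integer part of [p * 2 ^+ t]. Its recurrence through the digits is all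
    that the run depends on, so the analysis stays within the naturals. *)
Lemma runs_program (dig : nat -> bool) (prec : nat -> nat) n :
  prec 0 = 1 -> (forall t, prec t.+1 = prec t + prec t + dig t.+1) ->
  (forall t, 2 ^ t <= prec t) ->
  let e := up_log 2 n in let c := 2 ^ e in let Q := 4 * (c * c) in
  let s := (e + e).+2 in let M := Q * Q * Q * Q in
  exists l, [/\ runs dig program (init_state n) (program_cost n Q M e s)
      (St l (filled (cell n c Q (prec s) M) (3 * (M * n)))) & nth 0 l 0 = M].
Proof.
move=> prec0 precS prec_ge e c Q s M.
have QE : Q = 2 ^ s by rewrite /Q /s !expnS expnD (mulnA 2).
have ME : M = 16 ^ s.
  by rewrite /M QE -!expnMn.
have c0 : 0 < c by rewrite expn_gt0.
have Q0 : 0 < Q by rewrite QE expn_gt0.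
have QP : Q <= prec s by rewrite QE.
exists [:: M; c; Q; prec s; Q; s; M; M; 3 * (M * n); 0; 0; 0; 0; 0; 0; 0; 0].
split=> //; pose m0 : nat -> nat := fun=> 0.
have -> : init_state n = St [:: n; 0; 0; 0; 0; 0; 0; 0; 0; 0; 0; 0; 0; 0; 0; 0; 0] m0.
  rewrite /init_state /St; congr State; apply/funext => i.
  by do 17 (case: i => [|i] //=); rewrite nth_nil.
apply: (@runs_block _ [:: (1, Const 1); (2, Const 4)]) => //=.
rewrite /block_regs /=.
pose f1 t := St [:: n; 2 ^ t; 4 * (2 ^ t * 2 ^ t); 0; 0; 0; 0; 0; 0; 0; 0; 0; 0;
  0; 0; 0; 0] m0.
apply: (@runs_seq _ _ _ _ (f1 e)).
  apply: (runs_while (f := f1)) => // [t te|t te|] /=.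
  - rewrite eqb0 negbK ltnNge; apply/negP => /up_log_min => /(_ isT).
    by rewrite leqNgt te.
  - apply: (@runs_block_skip _ dim_step) => //; rewrite /block_regs /=.
    by congr [:: _, _, _ & _]; rewrite !expnS; move: (2 ^ t) => y; lia.
  - by rewrite ltnNge up_logP.
apply: (@runs_block _ [:: (3, Const 1); (4, Const 1); (6, Const 1)]) => //=.
rewrite /block_regs /= -/c -/Q.
pose f2 t := St [:: n; c; Q; prec t; 2 ^ t; t; 16 ^ t; 0; 0; 0; 0; 0; 0;
  0; 0; 0; 0] m0.
apply: (@runs_seq _ _ _ _ (f2 s)).
  set s0 := St _ _; have -> : s0 = f2 0 by rewrite /f2 prec0.
  apply: (runs_while (f := f2)) => // [t ts|t ts|] /=.
  - by rewrite QE ltn_exp2l // ts.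
  - apply: (@runs_block_skip _ digit_step) => //; rewrite /block_regs /=.
    rewrite addn1 -precS; congr [:: _, _, _, _, _, _, _ & _]; rewrite !expnS.
      by move: (2 ^ t) => y; lia.
    by move: (16 ^ t) => y; lia.
  - by rewrite QE ltnn.
pose f3 r := row_state n c Q (prec s) M Q s r.
apply: (@runs_seq _ _ _ _ (f3 M)); last first.
  by apply: (@runs_block_skip _ [:: (0, Reg 6)]).
have -> : f2 s = f3 0.
  by rewrite /f2 /f3 /row_state -ME -QE mul0n muln0; congr St.
apply: (runs_while (f := f3)) => // [r rM|r rM|] /=.
- by rewrite rM.
- exact: runs_row.
- by rewrite ltnn.
Qed.

(** * Polynomial and quasi-polynomial bounds on cost and size *)

Lemma leq_add_scaled a b A B Y : a <= A * Y -> b <= B * Y ->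
  a + b <= (A + B) * Y.
Proof. by rewrite mulnDl; exact: leq_add. Qed.

Lemma leq_mul_scaled a b A B Y Z : a <= A * Y -> b <= B * Z ->
  a * b <= A * B * (Y * Z).
Proof. by rewrite mulnACA; exact: leq_mul. Qed.

Lemma ltn_scaled a A Y : 0 < Y -> a <= A * Y -> a < A.+1 * Y.
Proof. by move=> Y0 h; rewrite mulSn -add1n; exact: leq_add. Qed.

(** At zero parameters every loop factor is 1, so that value of the cost serves as the constant. The
    exponent 6 is 4 for the rows, 1 for the columns and 1 for the scale loop. *)
Lemma program_cost_le n Q e s : n <= Q -> e <= Q -> s <= Q ->
  program_cost n Q (Q * Q * Q * Q) e s <= program_cost 0 0 0 0 0 * Q.+1 ^ 6.
Proof.
move=> nQ eQ sQ; set X := Q.+1.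
have X0 : 0 < X by [].
have XX k : 0 < X ^ k by rewrite expn_gt0.
have col : col_cost Q <= col_cost 0 * X.
  rewrite /col_cost; apply: leq_add_scaled; first exact: leq_pmulr.
  apply: leq_add_scaled; last exact: leq_pmulr.
  by rewrite /scale_cost mul1n mulnC.
have row : row_cost n Q <= row_cost 0 0 * X ^ 2.
  rewrite /row_cost; apply: leq_add_scaled; first exact: leq_pmulr.
  apply: leq_add_scaled; last exact: leq_pmulr.
  rewrite -mulnn; apply: leq_mul_scaled; first by rewrite mul1n.
  by apply: ltn_scaled => //; apply: leq_add_scaled; first exact: leq_pmulr.
have small k a : a <= X -> a * k <= 1 * k * X ^ 6.
  move=> aX; rewrite mul1n mulnC leq_mul2l; apply/orP; right.
  by apply: leq_trans aX _; rewrite -{1}(expn1 X) leq_pexp2l.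
rewrite /program_cost; apply: leq_add_scaled; first exact: leq_pmulr.
apply: leq_add_scaled; first exact: small.
apply: leq_add_scaled; first exact: leq_pmulr.
apply: leq_add_scaled; first exact: small.
apply: leq_add_scaled; last exact: leq_pmulr.
rewrite (_ : X ^ 6 = X ^ 4 * X ^ 2); last by rewrite -expnD.
apply: leq_mul_scaled; last first.
  by apply: ltn_scaled => //; apply: leq_add_scaled; first exact: leq_pmulr.
rewrite mul1n !expnS expn0 muln1 /X; nia.
Qed.

Local Open Scope ring_scope.

(** For [n >= 2] the constant factor [A] is below [n ^ A], so a fixed power of [n] bounds [t].
    Dividing its exponent by [ln 2 <= ln n] gives [K]. *)
Lemma quasipoly_of_poly (R : realType) (D B k : nat) : exists K : R,
  forall n t : nat, ((2 <= n)%N -> (t <= D * (B * n ^ 2) ^ k)%N) ->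
  quasipoly_le K n t.
Proof.
pose A := (D * B ^ k)%N; exists ((A + 2 * k)%:R / ln 2) => n t tle n2.
have l2 : 0 < ln 2 :> R by rewrite ln_gt0 // ltr1n.
have n0 : 0 < n%:R :> R by rewrite ltr0n ltnW.
apply: (@le_trans _ _ (n%:R `^ (A + 2 * k)%:R)).
  rewrite powR_mulrn // -natrX ler_nat; apply: leq_trans (tle n2) _.
  rewrite expnMn mulnA -/A -expnM expnD leq_mul2r; apply/orP; right.
  exact: ltnW (ltn_expl A n2).
rewrite ler_powR ?ler1n 1?ltnW //.
rewrite -mulrA ler_peMr // ler_pdivlMl // mulr1 ler_ln ?posrE //.
by rewrite ler_nat.
Qed.

Lemma truncn_double (R : realType) (x : R) : 0 <= x ->
  Num.truncn (2 * x) = (Num.truncn x + Num.truncn x +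
    odd (Num.truncn (2 * x)))%N.
Proof.
move=> x0; have h1 : (Num.truncn x)%:R <= x by rewrite truncn_le.
have h2 := truncnS_gt x; rewrite -natr1 in h2.
have x20 : 0 <= 2 * x by rewrite mulr_ge0.
set m := Num.truncn (2 * x); set t := Num.truncn x in h1 h2 *.
have l1 : (2 * t <= m)%N by rewrite truncn_ge_nat // natrM ler_wpM2l.
have l2 : (m < 2 * t.+1)%N.
  by rewrite truncn_lt_nat // natrM ltr_pM2l // -natr1.
have := odd_double_half m; rewrite -mul2n; lia.
Qed.

Theorem theorem1p5 (R : realType) (p : R) (hp1 : 1 < p) (hp2 : p < 2) :
  exists (c C K : R) (prog : com),
    [/\ 0 < c, 0 < C &
      forall n : nat, exists (m : nat) (A : 'M[R]_(m, n)),
        [/\ quasipoly_le K n m,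
            forall x : 'cV[R]_n,
              c * lpnorm p x <= lpnorm 1 (A *m x) /\
              lpnorm 1 (A *m x) <= C * lpnorm p x &
            exists t : nat, computes p prog A t /\ quasipoly_le K n t]].
Proof.
pose C0 := program_cost 0 0 0 0 0.
(* One [K] serves for size and time. From [c <= 2 * n] follows [Q.+1 <= 32 * n ^ 2]. The exponent
   doubles from 6 to 12 because the logarithmic cost is about the square of the step bound; the
   added 1 covers the number of rows. *)
have [K hK] := quasipoly_of_poly R (C0 * C0.+1 + 1) 32 12.
exists 48^-1, (1 + 4 ^+ 2 * upper_const p), K, program; split.
- by rewrite invr_gt0.
- have := upper_const_ge0 hp1 hp2; rewrite -(pmulr_rge0 _ (_ : 0 < 4 ^+ 2)) //.
  by move=> h; rewrite ltr_pwDl.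
move=> n; pose e := up_log 2 n; pose c := (2 ^ e)%N; pose Q := (4 * (c * c))%N.
pose s := (e + e).+2; pose M := (Q * Q * Q * Q)%N.
pose P := Num.truncn (p * Q%:R).
have p0 : 0 <= p by rewrite ltW // (lt_trans ltr01).
pose prec t := Num.truncn (p * 2 ^+ t).
have QE : Q = (2 ^ s)%N by rewrite /Q /s !expnS expnD (mulnA 2).
have PE : prec s = P by rewrite /prec /P QE natrX.
have nc : (n <= c)%N by exact: up_logP.
have prec0 : prec 0%N = 1%N by rewrite /prec mulr1; apply: truncn_def; rewrite (ltW hp1).
have precS t : prec t.+1 = (prec t + prec t + binary_digit p t.+1)%N.
  rewrite /binary_digit /prec exprS mulrCA [LHS]truncn_double //.
  by rewrite mulr_ge0 // exprn_ge0.
have prec_ge t : (2 ^ t <= prec t)%N.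
  rewrite /prec truncn_ge_nat; last by rewrite mulr_ge0 // exprn_ge0.
  by rewrite natrX ler_peMl ?exprn_ge0 // ltW.
have [l [hl l0]] := runs_program n prec0 precS prec_ge.
rewrite -/e -/c -/Q -/s -/M in hl l0.
have cQ : (c <= Q)%N.
  by rewrite /Q mulnCA leq_pmulr // muln_gt0 expn_gt0.
have nQ := leq_trans nc cQ.
have sQ : (s <= Q)%N by rewrite QE ltnW // ltn_expl.
have eQ : (e <= Q)%N by apply: leq_trans sQ; rewrite /s; lia.
have cost := program_cost_le nQ eQ sQ.
have XB : (2 <= n)%N -> (Q.+1 <= 32 * n ^ 2)%N.
  move=> n2; have c2n : (c <= 2 * n)%N.
    have := @up_log_bounds 2 n isT n2 => /andP[h _].
    have e0 : (0 < e)%N by rewrite up_log_gt0.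
    by rewrite /c -(prednK e0) expnS leq_mul2l ltnW ?orbT.
  have Q0 : (0 < Q)%N by rewrite QE expn_gt0.
  have : (c * c <= 2 * n * (2 * n))%N by exact: leq_mul.
  move: Q0; rewrite /Q -mulnn; lia.
have small k : (k <= (C0 * C0.+1 + 1) * Q.+1 ^ 12)%N -> quasipoly_le K n k.
  move=> h; apply: hK => n2; apply: leq_trans h _.
  by rewrite leq_mul2l leq_exp2r // XB ?orbT.
exists M, (sketch p n e); split.
- apply: small; apply: (@leq_trans (Q.+1 ^ 4)).
    by rewrite !expnS expn0 muln1 !mulnA !leq_mul.
  apply: (@leq_trans (Q.+1 ^ 12)); first by rewrite leq_pexp2l.
  by rewrite leq_pmull // addn1.
- by move=> x; exact: lpnorm_sketch.
(* A bit length of [n.+1] for the input is crude, but at most [Q.+1 ^ 6], so it is absorbed by the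
   step bound. *)
have binit : bounded (init_state n) n.+1.
  split=> i /=; last by rewrite expn_gt0.
  case: ifP => _; last by rewrite expn_gt0.
  by apply: ltn_trans (ltnSn n) _; rewrite ltn_expl.
have [_ [t ht tle]] := hl _ binit.
exists t; split.
  exists (St l (filled (cell n c Q (prec s) M) (3 * (M * n)))); split=> //.
  split=> // i j; rewrite /= /filled.
  have lt k : (k < 3)%N -> (3 * (i * n + j) + k < 3 * (M * n))%N.
    move=> k3; apply: (@leq_trans (3 * (i * n + j).+1)).
      by rewrite mulnS addnC ltn_add2r.
    rewrite leq_mul2l; apply: leq_trans (_ : i.+1 * n <= _)%N.
      by rewrite mulSn addnC ltn_add2r.
    by rewrite leq_mul2r ltn_ord orbT.
  have M0 : (0 < M)%N by rewrite !muln_gt0 !expn_gt0.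
  have := lt 2 isT; rewrite addn2 => ->.
  have := lt 1 isT; rewrite addn1 => ->.
  have := lt 0 isT; rewrite addn0 => ->.
  have := @cell_entry n c Q (prec s) M i j 2 (ltn_ord j) isT.
  rewrite /entry_addr addn2 /= => ->.
  have := @cell_entry n c Q (prec s) M i j 1 (ltn_ord j) isT.
  rewrite /entry_addr addn1 /= => ->.
  have := @cell_entry n c Q (prec s) M i j 0 (ltn_ord j) isT.
  rewrite /entry_addr addn0 /= => ->.
  split=> //; rewrite mxE PE -/Q -/P -/M.
  rewrite /hsign -/(hash2 Q i j) -/(hash1 Q i j).
  (* The sign decides which of the two stored numerators is the scale; the other is a quotient by 0,
     hence 0. *)
  by case: ifP => _; rewrite /= divn1 divn0 ?subr0 ?sub0r ?mul1r ?mulN1r.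
apply: small; apply: leq_trans tle _; move: cost; rewrite -/C0 -/Q -/M -/s.
move: (program_cost _ _ _ _ _) => N cost.
have X6 : (n.+1 <= Q.+1 ^ 6)%N.
  by apply: (@leq_trans Q.+1) => //; rewrite -{1}(expn1 Q.+1) leq_pexp2l.
apply: (@leq_trans (C0 * Q.+1 ^ 6 * (C0.+1 * Q.+1 ^ 6))).
  by apply: leq_mul => //; rewrite mulSn; exact: leq_add.
by rewrite mulnACA -expnD; apply: leq_mul => //; exact: leq_addr.
Qed.
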